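(* Let $M$ be a microlinear space. If $\omega_1$ is a $[D\to M]$-valued $p$-semiform on $M$, $\omega_2$ is a $[D\to M]$-valued $q$-semiform on $M$ and $\omega_3$ is a $[D\to M]$-valued $r$-semiform on $M$, then the following Jacobi identity holds for the three $[D\to M]$-valued $(p+q+r)$-semiforms on $M$: $$\lfloor \omega_1,\lfloor\omega_2,\omega_3\rfloor\rfloor+\lfloor \omega_2,\lfloor\omega_3,\omega_1\rfloor\rfloor^{\rho_1}+\lfloor \omega_3,\lfloor\omega_1,\omega_2\rfloor\rfloor^{\rho_2}=0 ,$$ where $\rho_1,\rho_2\in\mathbb{S}_{p+q+r}$ are the following permutations (in two-line notation): $$\rho_1=\begin{pmatrix}1&\dots&q&q+1&\dots&q+r&q+r+1&\dots&p+q+r\\ p+1&\dots&p+q&p+q+1&\dots&p+q+r&1&\dots&p\end{pmatrix},$$ $$\rho_2=\begin{pmatrix}1&\dots&r&r+1&\dots&p+r&p+r+1&\dots&p+q+r\\ p+q+1&\dots&p+q+r&1&\dots&p&p+1&\dots&p+q\end{pmatrix}.$$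
   Context: Setting: synthetic differential geometry, i.e. (intuitionistic) reasoning inside a cartesian closed universe of spaces, as in Lavendhomme's ''Basic Concepts of Synthetic Differential Geometry''. $[X\to Y]$ is the exponential $Y^X$. $\mathbb{R}$ is the line, a commutative ring satisfying the generalized Kock–Lawvere axiom (for each Weil algebra $W$ the canonical map $W\to[\mathrm{Spec}_{\mathbb R}W\to\mathbb{R}]$ is bijective). $D=\{d\in\mathbb{R}: d^2=0\}$, $D(2)=\{(d_1,d_2)\in D^2: d_1d_2=0\}$. A space $X$ is microlinear if every finite diagram of infinitesimal objects $\mathrm{Spec}_{\mathbb R}W$ with cocone which $[-\to\mathbb{R}]$ turns into a limit diagram is also turned into a limit diagram by $[-\to X]$. If $X$ is microlinear, so is $[Y\to X]$ for every space $Y$. The letters $p,q,r$ denote natural numbers. Tangent vectors: a tangent vector to a microlinear $X$ at $x$ is $t:D\to X$ with $t(0)=x$. Those at $x$ form an $\mathbb{R}$-module: $(\alpha t)(d)=t(\alpha d)$ and $(t_1+t_2)(d)=l(d,d)$, where $l:D(2)\to X$ is the unique map with $l(d,0)=t_1(d)$, $l(0,d)=t_2(d)$; zero is the constant map. Strong difference: for $\gamma_1,\gamma_2:D^2\to X$ ($X$ microlinear) with $\gamma_1|_{D(2)}=\gamma_2|_{D(2)}$, there is a unique $k:\{(d_1,d_2,e)\in D^3: d_1e=d_2e=0\}\to X$ with $k(d_1,d_2,0)=\gamma_2(d_1,d_2)$ and $k(d_1,d_2,d_1d_2)=\gamma_1(d_1,d_2)$; put $(\gamma_1\overset{\cdot}{-}\gamma_2)(e)=k(0,0,e)$.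 For $\gamma\in[D^p\to M]$, $\alpha\in\mathbb{R}$, $1\le i\le p$: $(\alpha\underset{i}{\cdot}\gamma)(d_1,\dots,d_p)=\gamma(d_1,\dots,\alpha d_i,\dots,d_p)$. For $\sigma$ in the permutation group $\mathbb{S}_p$ of $\{1,\dots,p\}$: $\gamma^\sigma(d_1,\dots,d_p)=\gamma(d_{\sigma(1)},\dots,d_{\sigma(p)})$. For $\varphi\in[[D^p\to M]\to M]$: $(\alpha\underset{i}{\cdot}\varphi)(\gamma)=\varphi(\alpha\underset{i}{\cdot}\gamma)$, $\varphi^\sigma(\gamma)=\varphi(\gamma^\sigma)$. The Dirac distribution is $\delta_{(0,\dots,0)}(\gamma)=\gamma(0,\dots,0)$. A $[D\to M]$-valued $p$-semiform on $M$ is a map $\omega:D\to[[D^p\to M]\to M]$ with $\omega(0)=\delta_{(0,\dots,0)}$ and $\alpha\underset{i}{\cdot}\omega(d)=\omega(\alpha d)$ for all $d\in D$, $\alpha\in\mathbb{R}$, $1\le i\le p$. Sums and scalar multiples of semiforms are those of tangent vectors to $[[D^p\to M]\to M]$ at $\delta_{(0,\dots,0)}$. Put $\omega^\sigma(d)=(\omega(d))^\sigma$. Convolutions: for $f\in[[A\to M]\to M]$, $g\in[[B\to M]\to M]$, define $f\ast g,\ f\,\widetilde{\ast}\,g\in[[A\times B\to M]\to M]$ by $(f\ast g)(h)=f(\lambda a.\,g(\lambda b.\,h(a,b)))$ and $(f\,\widetilde{\ast}\,g)(h)=g(\lambda b.\,f(\lambda a.\,h(a,b)))$. For a $p$-semiform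 $\omega_1$ and a $q$-semiform $\omega_2$, put $(\omega_1\circledast\omega_2)(d_1,d_2)=\omega_1(d_1)\ast\omega_2(d_2)$ and $(\omega_1\widetilde{\circledast}\omega_2)(d_1,d_2)=\omega_1(d_1)\,\widetilde{\ast}\,\omega_2(d_2)$ (with $D^p\times D^q=D^{p+q}$); these agree on $D(2)$, and $\lfloor\omega_1,\omega_2\rfloor=\omega_1\widetilde{\circledast}\omega_2\overset{\cdot}{-}\omega_1\circledast\omega_2$, which is a $(p+q)$-semiform.
   Formalization: With the stated conventions for γ^σ and two-line notation, the displayed identity fails already for p=q=r=1; the formal theorem uses the inverses of ρ1 and ρ2 (arrays read from bottom to top), so that each ω_i acts on the same arguments in all three terms. *)

(* Defs.v *)
From mathcomp Require Import all_boot fingroup perm zify.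
From Stdlib Require Import Ring_theory Ring.

Set Implicit Arguments.
Unset Strict Implicit.
Unset Printing Implicit Defensive.

(* A cartesian closed universe of spaces with finite limits.  Spaces are      *)
(* given by their elements, and a map is determined by its effect on elements *)
(* as in the internal language of a topos.  The maps need not be all the      *)
(* functions between the types of elements.  If they are (Rocq types with all *)
(* functions form such a universe, which is the internal reading), the        *)
(* Kock-Lawvere axiom contradicts excluded middle with choice; leaving the    *)
(* notion of map open also covers, say, concrete sheaves with smooth maps.    *)
Record cc_universe : Type := CCUniverse {
  space : Type;
  pt : space -> Type;
  is_map : forall X Y : space, (pt X -> pt Y) -> Prop;
  map_id : forall X, @is_map X X (fun x => x);
  map_const : forall X Y (y : pt Y), @is_map X Y (fun _ => y);
  map_comp : forall X Y Z (f : pt X -> pt Y) (g : pt Y -> pt Z),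
    is_map f -> is_map g -> is_map (fun x => g (f x));
  map_ext : forall X Y (f g : pt X -> pt Y),
    (forall x, f x = g x) -> is_map f -> is_map g;
  (* terminal space and binary products *)
  one : space;
  star : pt one;
  one_eta : forall x : pt one, x = star;
  times : space -> space -> space;
  opair : forall X Y, pt X -> pt Y -> pt (times X Y);
  pr1 : forall X Y, pt (times X Y) -> pt X;
  pr2 : forall X Y, pt (times X Y) -> pt Y;
  pr1_pair : forall X Y (x : pt X) (y : pt Y), pr1 (opair x y) = x;
  pr2_pair : forall X Y (x : pt X) (y : pt Y), pr2 (opair x y) = y;
  pair_eta : forall X Y (z : pt (times X Y)), opair (pr1 z) (pr2 z) = z;
  map_pr1 : forall X Y, is_map (@pr1 X Y);
  map_pr2 : forall X Y, is_map (@pr2 X Y);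
  map_pair : forall X Y Z (f : pt Z -> pt X) (g : pt Z -> pt Y),
    is_map f -> is_map g -> is_map (fun z => opair (f z) (g z));
  (* exponentials: the elements of expo X Y are the maps from X to Y *)
  expo : space -> space -> space;
  app : forall X Y, pt (expo X Y) -> pt X -> pt Y;
  lam : forall X Y (f : pt X -> pt Y), is_map f -> pt (expo X Y);
  app_lam : forall X Y (f : pt X -> pt Y) (Hf : is_map f) x,
    app (lam Hf) x = f x;
  app_ext : forall X Y (f g : pt (expo X Y)),
    (forall x, app f x = app g x) -> f = g;
  map_eval : forall X Y,
    @is_map (times (expo X Y) X) Y (fun z => app (pr1 z) (pr2 z));
  map_curry : forall X Y Z (f : pt Z -> pt X -> pt Y)
      (Hf : forall z, is_map (f z)),
    @is_map (times Z X) Y (fun z => f (pr1 z) (pr2 z)) ->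
    is_map (fun z => lam (Hf z));
  (* equalizers: eqsp Hf Hg is the subspace {x in X | f x = g x} *)
  eqsp : forall X Y (f g : pt X -> pt Y), is_map f -> is_map g -> space;
  incl : forall X Y (f g : pt X -> pt Y) (Hf : is_map f) (Hg : is_map g),
    pt (eqsp Hf Hg) -> pt X;
  elem : forall X Y (f g : pt X -> pt Y) (Hf : is_map f) (Hg : is_map g) x,
    f x = g x -> pt (eqsp Hf Hg);
  incl_elem : forall X Y (f g : pt X -> pt Y) (Hf : is_map f) (Hg : is_map g)
    x (Hx : f x = g x), incl (elem Hf Hg Hx) = x;
  incl_eq : forall X Y (f g : pt X -> pt Y) (Hf : is_map f) (Hg : is_map g)
    (x : pt (eqsp Hf Hg)), f (incl x) = g (incl x);
  incl_inj : forall X Y (f g : pt X -> pt Y) (Hf : is_map f) (Hg : is_map g)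
    (x y : pt (eqsp Hf Hg)), incl x = incl y -> x = y;
  map_incl : forall X Y (f g : pt X -> pt Y) (Hf : is_map f) (Hg : is_map g),
    is_map (@incl X Y f g Hf Hg);
  map_factor : forall X Y (f g : pt X -> pt Y) (Hf : is_map f) (Hg : is_map g)
    Z (h : pt Z -> pt (eqsp Hf Hg)),
    is_map (fun z => incl (h z)) -> is_map h
}.

Coercion pt : space >-> Sortclass.
Coercion app : pt >-> Funclass.

Arguments is_map {c X Y} f.
Arguments star {c}.
Arguments one {c}.
Arguments opair {c X Y} _ _.
Arguments pr1 {c X Y} _.
Arguments pr2 {c X Y} _.
Arguments app {c X Y} _ _.
Arguments lam {c X Y} f Hf : rename.
Arguments incl {c X Y f g Hf Hg} _.
Arguments elem {c X Y f g Hf Hg} x & _.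
Arguments eqsp {c X Y} f g Hf Hg : rename.

Notation "X ~> Y" := (expo X Y) (at level 55, right associativity).

Section MapCombinators.
Variable U : cc_universe.
Implicit Types X Y Z : space U.

Lemma map_app X Y Z (f : Z -> X ~> Y) (a : Z -> X) :
  is_map f -> is_map a -> is_map (fun z => f z (a z)).
Proof.
move=> Hf Ha; apply: map_ext (map_comp (map_pair Hf Ha) (map_eval X Y)) => z.
by rewrite pr1_pair pr2_pair.
Qed.

Lemma map_fst X Y Z (f : Z -> times X Y) :
  is_map f -> is_map (fun z => pr1 (f z)).
Proof. by move=> Hf; apply: map_comp Hf (map_pr1 X Y). Qed.

Lemma map_snd X Y Z (f : Z -> times X Y) :
  is_map f -> is_map (fun z => pr2 (f z)).
Proof. by move=> Hf; apply: map_comp Hf (map_pr2 X Y). Qed.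

Lemma map_incl_of X Y Z (f g : X -> Y) (Hf : is_map f) (Hg : is_map g)
    (h : Z -> eqsp f g Hf Hg) :
  is_map h -> is_map (fun z => incl (h z)).
Proof. by move=> Hh; apply: map_comp Hh (map_incl Hf Hg). Qed.

Lemma map_elem X Y Z (f g : X -> Y) (Hf : is_map f) (Hg : is_map g)
    (h : Z -> X) (E : forall z, f (h z) = g (h z)) :
  is_map h -> is_map (fun z => elem (h z) (E z) : eqsp f g Hf Hg).
Proof.
by move=> Hh; apply: map_factor; apply: map_ext Hh => z; rewrite incl_elem.
Qed.

Lemma ord_0_elim : 'I_0 -> False.
Proof. by case. Qed.

Fixpoint power X n : space U := if n is m.+1 then times X (power X m) else one.

Fixpoint coord X n : power X n -> 'I_n -> X :=
  match n with
  | 0 => fun _ i => False_rect X (ord_0_elim i)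
  | m.+1 => fun x i =>
      if unlift ord0 i is Some j then coord (pr2 x) j else pr1 x
  end.

Fixpoint tup X n : ('I_n -> X) -> power X n :=
  match n with
  | 0 => fun _ => star
  | m.+1 => fun f => opair (f ord0) (tup (fun j => f (lift ord0 j)))
  end.

Lemma coord_tup X n (f : 'I_n -> X) i : coord (tup f) i = f i.
Proof.
elim: n f i => [|n IH] f i /=; first by case: (ord_0_elim i).
by case: unliftP => [j|] ->; rewrite ?pr2_pair ?pr1_pair ?IH.
Qed.

Lemma map_coord X n Z (f : Z -> power X n) i :
  is_map f -> is_map (fun z => coord (f z) i).
Proof.
elim: n f i => [|n IH] f i Hf /=; first by case: (ord_0_elim i).
case: (unlift ord0 i) => [j|]; last exact: map_fst.
by apply: IH; apply: map_snd.
Qed.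

Lemma map_tup X n Z (f : Z -> 'I_n -> X) :
  (forall i, is_map (fun z => f z i)) -> is_map (fun z => tup (f z)).
Proof.
elim: n f => [|n IH] f Hf /=; first exact: map_const.
by apply: map_pair => //; apply: IH => i; apply: Hf.
Qed.

End MapCombinators.

Declare Scope line_scope.
Delimit Scope line_scope with L.

Record line (U : cc_universe) : Type := Line {
  line_space : space U;
  l0 : line_space;
  l1 : line_space;
  ladd : line_space -> line_space -> line_space;
  lmul : line_space -> line_space -> line_space;
  lopp : line_space -> line_space;
  line_ring : ring_theory l0 l1 ladd lmul (fun x y => ladd x (lopp y)) lopp eq;
  map_ladd : is_map (fun z : times line_space line_space =>
    ladd (pr1 z) (pr2 z));
  map_lmul : is_map (fun z : times line_space line_space =>
    lmul (pr1 z) (pr2 z))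
}.

Coercion line_space : line >-> space.

Arguments l0 {U l}.
Arguments l1 {U l}.
Notation "0" := l0 : line_scope.
Notation "1" := l1 : line_scope.
Notation "x + y" := (ladd x y) : line_scope.
Notation "x * y" := (lmul x y) : line_scope.
Notation "\sum_ ( i < n ) e" := (\big[@ladd _ _/l0]_(i < n) e%L) : line_scope.

Section Line.
Variables (U : cc_universe) (R : line U).
Implicit Types X Y Z : space U.
Local Open Scope line_scope.

Add Ring line_ring_tac : (line_ring R).

Lemma map_add Z (f g : Z -> R) :
  is_map f -> is_map g -> is_map (fun z => f z + g z).
Proof.
move=> Hf Hg; apply: map_ext (map_comp (map_pair Hf Hg) (map_ladd R)) => z.
by rewrite pr1_pair pr2_pair.
Qed.

Lemma map_mul Z (f g : Z -> R) :
  is_map f -> is_map g -> is_map (fun z => f z * g z).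
Proof.
move=> Hf Hg; apply: map_ext (map_comp (map_pair Hf Hg) (map_lmul R)) => z.
by rewrite pr1_pair pr2_pair.
Qed.

Lemma map_sum Z n (f : 'I_n -> Z -> R) :
  (forall i, is_map (f i)) -> is_map (fun z => \sum_(i < n) f i z).
Proof.
move=> Hf; rewrite unlock; elim: (index_enum _) => [|i s IH] /=.
  exact: map_const.
exact: map_add.
Qed.

End Line.

(* proves is_map (fun z => e) for e built from the operations above *)
Ltac map_tac :=
  lazymatch goal with
  | H : is_map ?f |- is_map ?f => exact H
  | |- is_map (fun z => z) => apply: map_id
  | |- is_map (fun _ => ?c) => apply: map_const
  | |- is_map (fun z => app (@?f z) (@?a z)) =>
      apply: (map_app (f := f) (a := a)); map_tac
  | |- is_map (fun z => opair (@?f z) (@?a z)) =>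
      apply: (map_pair (f := f) (g := a)); map_tac
  | |- is_map (fun z => pr1 (@?f z)) => apply: (map_fst (f := f)); map_tac
  | |- is_map (fun z => pr2 (@?f z)) => apply: (map_snd (f := f)); map_tac
  | |- is_map (fun z => coord (@?f z) _) => apply: (map_coord (f := f)); map_tac
  | |- is_map (fun z => tup (@?f z)) =>
      apply: (map_tup (f := f)); let i := fresh "i" in
      move=> i; cbv beta; map_tac
  | |- is_map (fun z => incl (@?f z)) =>
      refine (@map_incl_of _ _ _ _ _ _ _ _ f _); map_tac
  | |- is_map (fun z => elem (@?f z) (@?H z)) =>
      refine (@map_elem _ _ _ _ _ _ _ _ f H _); map_tac
  | |- is_map (fun z => lam (@?f z) (@?H z)) =>
      refine (@map_curry _ _ _ _ f H _); cbv beta; map_tac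
  | |- is_map (fun z => match ?c with inl _ => _ | inr _ => _ end) =>
      case: c => ?; map_tac
  | |- is_map (fun z => if ?c then _ else _) => case: c; map_tac
  | |- is_map (fun z => ladd (@?f z) (@?g z)) =>
      apply: (map_add (f := f) (g := g)); map_tac
  | |- is_map (fun z => lmul (@?f z) (@?g z)) =>
      apply: (map_mul (f := f) (g := g)); map_tac
  | |- is_map (fun z => bigop _ _ (fun i => BigBody i _ true (@?f z i))) =>
      refine (@map_sum _ _ _ _ (fun i z => f z i) _); let i := fresh "i" in
      move=> i; cbv beta; map_tac
  | |- is_map _ => progress autounfold with maps; map_tac
  end.

Notation mlam f := (lam f ltac:(map_tac)) (only parsing).

Section WeilAlgebras.
Variables (U : cc_universe) (R : line U).
Implicit Types X Y Z : space U.
Local Open Scope line_scope.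

(* the bilinear multiplication on R^n with structure constants c *)
Definition smul n (c : 'I_n -> 'I_n -> 'I_n -> R) (u v : 'I_n -> R)
  : 'I_n -> R :=
  fun k => \sum_(i < n) \sum_(j < n) (c i j k * (u i * v j)).

(* smul_prod c v N = v 0 * v 1 * ... * v N *)
Fixpoint smul_prod n (c : 'I_n -> 'I_n -> 'I_n -> R) (v : nat -> 'I_n -> R) N
  : 'I_n -> R :=
  if N is N'.+1 then smul c (smul_prod c v N') (v N) else v 0%N.

(* A Weil algebra W = R + m, with unit (1, 0), is given by its augmentation   *)
(* ideal m, a nilpotent commutative non-unital algebra with underlying module *)
(* R^n.                                                                       *)
Record weil : Type := Weil {
  wdim : nat;
  wstr : 'I_wdim -> 'I_wdim -> 'I_wdim -> R;
  wmulC : forall u v k, smul wstr u v k = smul wstr v u k;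
  wmulA : forall u v w k,
    smul wstr u (smul wstr v w) k = smul wstr (smul wstr u v) w k;
  wnil : exists N, forall v k, smul_prod wstr v N k = 0
}.

Definition wspace (W : weil) : space U := times R (power R (wdim W)).

(* Spec_R W, the space of R-algebra maps W -> R: such a map is given by the   *)
(* images x_i of the basis vectors e_i of m, subject to the equations         *)
(* x_i x_j = \sum_k wstr i j k * x_k.                                         *)
Definition spec_lhs (W : weil) (x : power R (wdim W)) :
  power (power R (wdim W)) (wdim W) :=
  tup (fun i => tup (fun j => coord x i * coord x j)).

Definition spec_rhs (W : weil) (x : power R (wdim W)) :
  power (power R (wdim W)) (wdim W) :=
  tup (fun i => tup (fun j => \sum_(k < wdim W) (wstr i j k * coord x k))).

Lemma map_spec_lhs W : is_map (@spec_lhs W).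
Proof. by rewrite /spec_lhs; map_tac. Qed.

Lemma map_spec_rhs W : is_map (@spec_rhs W).
Proof. by rewrite /spec_rhs; map_tac. Qed.

Definition Spec (W : weil) : space U :=
  eqsp (@spec_lhs W) (@spec_rhs W) (map_spec_lhs W) (map_spec_rhs W).

Definition weval (W : weil) (w : wspace W) (x : Spec W) : R :=
  pr1 w + \sum_(k < wdim W) (coord (pr2 w) k * coord (incl x) k).

Lemma map_weval2 W :
  is_map (fun z : times (wspace W) (Spec W) => weval (pr1 z) (pr2 z)).
Proof. by rewrite /weval; map_tac. Qed.

Lemma map_weval W (w : wspace W) : is_map (weval w).
Proof. by rewrite /weval; map_tac. Qed.

Definition canonical (W : weil) : wspace W ~> Spec W ~> R :=
  lam (fun w => lam (weval w) (map_weval w)) (map_curry _ (map_weval2 W)).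

Definition bijective_map X Y (f : X ~> Y) : Prop :=
  exists g : Y ~> X, (forall x, g (f x) = x) /\ (forall y, f (g y) = y).

Definition kock_lawvere : Prop := forall W : weil, bijective_map (canonical W).

(* A finite diagram of infinitesimal objects, together with a cocone on it *)
Record cocone : Type := Cocone {
  nobj : nat;
  narr : nat;
  obj : 'I_nobj -> weil;
  src : 'I_narr -> 'I_nobj;
  tgt : 'I_narr -> 'I_nobj;
  arr : forall a, Spec (obj (src a)) ~> Spec (obj (tgt a));
  vertex : weil;
  leg : forall i, Spec (obj i) ~> Spec vertex;
  leg_arr : forall a x, leg (tgt a) (arr a x) = leg (src a) x
}.

(* [- -> X] turns the cocone C into a limit diagram of spaces *)
Definition limit_under (C : cocone) X : Prop :=
  forall Z (g : forall i : 'I_(nobj C), Z ~> Spec (obj i) ~> X),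
    (forall (a : 'I_(narr C)) z x, g (tgt a) z (arr a x) = g (src a) z x) ->
    exists! h : Z ~> Spec (vertex C) ~> X,
      forall i z x, h z (leg i x) = g i z x.

Definition microlinear X : Prop :=
  forall C : cocone, limit_under C R -> limit_under C X.

End WeilAlgebras.

Section TangentVectors.
Variables (U : cc_universe) (R : line U).
Implicit Types X : space U.
Local Open Scope line_scope.

Add Ring line_ring_tac' : (line_ring R).

Lemma map_sq : is_map (fun d : R => d * d).
Proof. map_tac. Qed.

Definition D : space U :=
  eqsp (fun d : R => d * d) (fun=> 0) map_sq (map_const _ _).

Lemma D_eq (d : D) : incl d * incl d = 0.
Proof. exact: (incl_eq d). Qed.

Lemma D0_eq : 0 * 0 = 0 :> R. Proof. ring. Qed.
Definition D0 : D := elem 0 D0_eq.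

Lemma Dscale_eq (a : R) (d : D) : (a * incl d) * (a * incl d) = 0.
Proof. by transitivity (a * a * (incl d * incl d)); [|rewrite D_eq]; ring. Qed.
Definition Dscale (a : R) (d : D) : D := elem (a * incl d) (Dscale_eq a d).

Lemma Dmul_eq (d1 d2 : D) :
  (incl d1 * incl d2) * (incl d1 * incl d2) = 0.
Proof.
by transitivity ((incl d1 * incl d1) * (incl d2 * incl d2));
  [|rewrite D_eq]; ring.
Qed.
Definition Dmul (d1 d2 : D) : D := elem (incl d1 * incl d2) (Dmul_eq d1 d2).

Lemma map_D2 : is_map (fun z : times D D => incl (pr1 z) * incl (pr2 z)).
Proof. map_tac. Qed.

Definition D2 : space U :=
  eqsp (fun z : times D D => incl (pr1 z) * incl (pr2 z)) (fun=> 0)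
    map_D2 (map_const _ _).

Lemma D2l_eq (d : D) :
  incl (pr1 (opair d D0)) * incl (pr2 (opair d D0)) = 0.
Proof. by rewrite pr1_pair pr2_pair incl_elem; ring. Qed.
Definition D2l (d : D) : D2 := elem (opair d D0) (D2l_eq d).

Lemma D2r_eq (d : D) :
  incl (pr1 (opair D0 d)) * incl (pr2 (opair D0 d)) = 0.
Proof. by rewrite pr1_pair pr2_pair incl_elem; ring. Qed.
Definition D2r (d : D) : D2 := elem (opair D0 d) (D2r_eq d).

Lemma D2diag_eq (d : D) : incl (pr1 (opair d d)) * incl (pr2 (opair d d)) = 0.
Proof. by rewrite pr1_pair pr2_pair D_eq. Qed.
Definition D2diag (d : D) : D2 := elem (opair d d) (D2diag_eq d).

(* D21 = {((d1, d2), e) | d1 e = d2 e = 0} *)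
Definition D21_lhs (z : times (times D D) D) : times R R :=
  opair (incl (pr1 (pr1 z)) * incl (pr2 z)) (incl (pr2 (pr1 z)) * incl (pr2 z)).

Lemma map_D21_lhs : is_map D21_lhs.
Proof. by rewrite /D21_lhs; map_tac. Qed.

Definition D21 : space U :=
  eqsp D21_lhs (fun=> opair 0 0) map_D21_lhs (map_const _ _).

Lemma D21_face_eq (d1 d2 : D) : D21_lhs (opair (opair d1 d2) D0) = opair 0 0.
Proof.
by rewrite /D21_lhs !(pr1_pair, pr2_pair) incl_elem; congr opair; ring.
Qed.
Definition D21_face d1 d2 : D21 :=
  elem (opair (opair d1 d2) D0) (D21_face_eq d1 d2).

Lemma D21_graph_eq (d1 d2 : D) :
  D21_lhs (opair (opair d1 d2) (Dmul d1 d2)) = opair 0 0.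
Proof.
rewrite /D21_lhs !(pr1_pair, pr2_pair) incl_elem; congr opair.
  by transitivity ((incl d1 * incl d1) * incl d2); [|rewrite D_eq]; ring.
by transitivity (incl d1 * (incl d2 * incl d2)); [|rewrite D_eq]; ring.
Qed.
Definition D21_graph d1 d2 : D21 :=
  elem (opair (opair d1 d2) (Dmul d1 d2)) (D21_graph_eq d1 d2).

Lemma D21_axis_eq (e : D) : D21_lhs (opair (opair D0 D0) e) = opair 0 0.
Proof.
by rewrite /D21_lhs !(pr1_pair, pr2_pair) incl_elem; congr opair; ring.
Qed.
Definition D21_axis e : D21 := elem (opair (opair D0 D0) e) (D21_axis_eq e).

(* t = t1 + t2.  Existence and uniqueness of l are part of the definition, so *)
(* t is determined by t1 and t2.                                              *)
Definition is_tangent_sum X (t1 t2 t : D ~> X) : Prop :=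
  exists l : D2 ~> X,
    unique (fun l : D2 ~> X =>
      (forall d, l (D2l d) = t1 d) /\ (forall d, l (D2r d) = t2 d)) l /\
    forall d, t d = l (D2diag d).

(* t is the strong difference of g1 and g2.  Existence and uniqueness of k    *)
(* are part of the definition, so t is determined by g1 and g2.               *)
Definition is_strong_difference X (g1 g2 : times D D ~> X) (t : D ~> X)
  : Prop :=
  (forall x : D2, g1 (incl x) = g2 (incl x)) /\
  exists k : D21 ~> X,
    unique (fun k : D21 ~> X => forall d1 d2,
      k (D21_face d1 d2) = g2 (opair d1 d2) /\
      k (D21_graph d1 d2) = g1 (opair d1 d2)) k /\
    forall e, t e = k (D21_axis e).

End TangentVectors.

#[export] Hint Unfold Dscale : maps.

Section Semiforms.
Variables (U : cc_universe) (R : line U) (M : space U).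
Implicit Types A B : space U.

Notation D := (D R).

(* [[A -> M] -> M] *)
Definition dist A : space U := (A ~> M) ~> M.

Definition scale p (i : 'I_p) (a : R) (g : power D p ~> M) : power D p ~> M :=
  mlam (fun d : power D p =>
    g (tup (fun j => if j == i then Dscale a (coord d j) else coord d j))).

Definition permute p (s : {perm 'I_p}) (g : power D p ~> M) : power D p ~> M :=
  mlam (fun d : power D p => g (tup (fun i => coord d (s i)))).

Hint Unfold scale permute : maps.

Definition dist_scale p (i : 'I_p) (a : R) (phi : dist (power D p)) :
  dist (power D p) :=
  mlam (fun g : power D p ~> M => phi (scale i a g)).

Definition dist_permute p (s : {perm 'I_p}) (phi : dist (power D p)) :
  dist (power D p) :=
  mlam (fun g : power D p ~> M => phi (permute s g)).

Hint Unfold dist_permute : maps.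

Definition dirac0 p : dist (power D p) :=
  mlam (fun g : power D p ~> M => g (tup (fun=> D0 R))).

(* the [D -> M]-valued p-semiforms on M *)
Record semiform p : Type := Semiform {
  form_of :> D ~> dist (power D p);
  form_of0 : form_of (D0 R) = dirac0 p;
  form_of_scale : forall (i : 'I_p) (a : R) (d : D),
    dist_scale i a (form_of d) = form_of (Dscale a d)
}.

Definition form_permute p (s : {perm 'I_p}) (w : D ~> dist (power D p)) :
  D ~> dist (power D p) :=
  mlam (fun d : D => dist_permute s (w d)).

Definition form_zero p : D ~> dist (power D p) :=
  mlam (fun d : D => dirac0 p).

Definition conv A B (f : dist A) (g : dist B) : dist (times A B) :=
  mlam (fun h : times A B ~> M =>
    f (mlam (fun a : A => g (mlam (fun b : B => h (opair a b)))))).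

Definition conv_tilde A B (f : dist A) (g : dist B) : dist (times A B) :=
  mlam (fun h : times A B ~> M =>
    g (mlam (fun b : B => f (mlam (fun a : A => h (opair a b)))))).

(* the identification D^p * D^q = D^(p + q) and its effect on distributions *)
Definition join_coords p q (a : power D p) (b : power D q) : power D (p + q) :=
  tup (fun i => match split i with
                | inl j => coord a j
                | inr j => coord b j
                end).

Hint Unfold join_coords : maps.

Definition dist_join p q (phi : dist (times (power D p) (power D q))) :
  dist (power D (p + q)) :=
  mlam (fun h : power D (p + q) ~> M =>
    phi (mlam (fun z : times (power D p) (power D q) =>
      h (join_coords (pr1 z) (pr2 z))))).

Hint Unfold conv conv_tilde dist_join : maps.

Definition circ p q (w1 : D ~> dist (power D p)) (w2 : D ~> dist (power D q)) :
  times D D ~> dist (power D (p + q)) :=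
  mlam (fun d : times D D => dist_join (conv (w1 (pr1 d)) (w2 (pr2 d)))).

Definition circ_tilde p q (w1 : D ~> dist (power D p))
    (w2 : D ~> dist (power D q)) : times D D ~> dist (power D (p + q)) :=
  mlam (fun d : times D D => dist_join (conv_tilde (w1 (pr1 d)) (w2 (pr2 d)))).

(* b is the bracket of w1 and w2 *)
Definition is_bracket p q (w1 : semiform p) (w2 : semiform q)
    (b : semiform (p + q)) : Prop :=
  is_strong_difference (circ_tilde w1 w2) (circ w1 w2) b.

(* transport along D^m = D^n for m = n *)
Definition form_cast m n (e : m = n) (w : D ~> dist (power D m)) :
  D ~> dist (power D n) :=
  ecast k (D ~> dist (power D k)) e w.

End Semiforms.

Lemma rot1_eq p q r : (q + (r + p) = p + q + r)%N.
Proof. by rewrite addnA addnC addnA. Qed.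

Lemma rot2_eq p q r : (r + (p + q) = p + q + r)%N.
Proof. by rewrite addnC. Qed.

(* The two-line arrays, from top to bottom, with indices starting from 0.     *)
(* rho1 (resp. rho2) sends the position of an argument of [w2, [w3, w1]]      *)
(* (resp. [w3, [w1, w2]]) to its position in D^p * D^q * D^r.  Since permute  *)
(* puts the argument number s i in position i, the inverses of rho1 and rho2  *)
(* are needed for each w_i to act on the same arguments in the three terms of *)
(* the Jacobi identity; with rho1 and rho2 it already fails for p = q = r = 1.*)
Definition rho1_val p q r (i : nat) : nat :=
  if (i < q)%N then (p + i)%N
  else if (i < q + r)%N then (p + q + (i - q))%N
  else (i - (q + r))%N.

Definition rho2_val p q r (i : nat) : nat :=
  if (i < r)%N then (p + q + i)%N
  else if (i < p + r)%N then (i - r)%N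
  else (p + (i - (p + r)))%N.

Lemma rho1_lt p q r (i : 'I_(p + q + r)) : (rho1_val p q r i < p + q + r)%N.
Proof. by have := ltn_ord i; rewrite /rho1_val; do 2?case: ifP; lia. Qed.

Lemma rho2_lt p q r (i : 'I_(p + q + r)) : (rho2_val p q r i < p + q + r)%N.
Proof. by have := ltn_ord i; rewrite /rho2_val; do 2?case: ifP; lia. Qed.

Lemma rho1_inj p q r : injective (fun i => Ordinal (@rho1_lt p q r i)).
Proof.
move=> i j [] E; apply: val_inj; move: E (ltn_ord i) (ltn_ord j) => /=.
by rewrite /rho1_val; do 4?case: ifP; lia.
Qed.

Lemma rho2_inj p q r : injective (fun i => Ordinal (@rho2_lt p q r i)).
Proof.
move=> i j [] E; apply: val_inj; move: E (ltn_ord i) (ltn_ord j) => /=.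
by rewrite /rho2_val; do 4?case: ifP; lia.
Qed.

Definition rho1 p q r : {perm 'I_(p + q + r)} := perm (@rho1_inj p q r).
Definition rho2 p q r : {perm 'I_(p + q + r)} := perm (@rho2_inj p q r).

(* Main.v *)
(* The words without repeated letters that are subwords of given words (the   *)
(* "facets") form the basis of a Weil algebra, with the shuffle product.      *)
(* Its spectrum glues the spectra of the facets, which are cubes D^n, along   *)
(* their intersections: D(2) has the facets 0 and 1, and the domain D21 of    *)
(* the strong difference has the facets 01 and 10.  Hence the six             *)
(* convolutions of w1(d1), w2(d2) and w3(d3), one for each order, glue to a   *)
(* single map l on the spectrum with facets the six permutations of 012.  A   *)
(* point of that spectrum is a character of the shuffle algebra, that is, a   *)
(* group-like noncommutative polynomial in the letters.  The iterated         *)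
(* brackets are the values of l along the primitive directions [0,[1,2]],     *)
(* [1,[2,0]] and [2,[0,1]], so that the Jacobi identity for semiforms is that *)
(* of the free Lie algebra.                                                   *)
Require Import Defs.
From HB Require Import structures.
From mathcomp Require Import all_boot fingroup perm zify.
From Stdlib Require Import Ring_theory Ring.

Set Implicit Arguments.
Unset Strict Implicit.
Unset Printing Implicit Defensive.

(** * Shuffle Weil algebras *)

(** A strong difference glues two squares, one for each order of convolution of two forms. The
    Jacobi identity involves six orders of three forms, and the proof glues these six convolutions
    into one map [l] ([run_glue]), on the spectrum of a shuffle algebra.

    Gluing works because, by Kock-Lawvere, a function on the spectrum with facets [F] is a family of
    coefficients indexed by the empty word and [lang F]. This language is the union of those of the
    facets, and overlaps have the intersections as languages, so compatible families glue uniquely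
    ([facet_limit]). Microlinearity carries this over to other spaces ([glue], [glue_on],
    [eq_on_facets]). The convolutions are compatible since a form at parameter 0 is a Dirac
    distribution and can be erased from the order ([acts_subseq], [run_meet]).

    Points of the spectrum are group-like polynomials, so infinitesimal objects map to it by
    explicit products. In two letters, (d1, d2, e) in [D21] is (1 + d1 X0)(1 + d2 X1)(1 + e
    [X1, X0]), and a bracket is the value along 1 + e [X1, X0]. Doing this twice, with [psi] and
    [psi'] for the inner bracket and [chi] for the outer one, shows that an iterated bracket is the
    value of [l] along 1 + e [a, [b, c]] ([push_bracket3]). Finally [l] composed with [phi], at 1 +
    x [0, [1, 2]] + y [1, [2, 0]], is the map on D(2) that defines the sum of the first two
    brackets. By the Jacobi identity of the free Lie algebra its diagonal is 1 - d [2, [0, 1]]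
    ([phi_diag]), so the sum is the opposite of the third bracket. *)

Section LineMonoid.
Variables (U : cc_universe) (R : line U).
Local Open Scope line_scope.
Add Ring line_ring_tac : (line_ring R).

Lemma laddA : associative (@ladd U R). Proof. by move=> x y z; ring. Qed.
Lemma laddC : commutative (@ladd U R). Proof. by move=> x y; ring. Qed.
Lemma ladd0l : left_id l0 (@ladd U R). Proof. by move=> x; ring. Qed.
Lemma lmul0l : left_zero l0 (@lmul U R). Proof. by move=> x; ring. Qed.
Lemma lmul0r : right_zero l0 (@lmul U R). Proof. by move=> x; ring. Qed.
Lemma lmulDl : left_distributive (@lmul U R) (@ladd U R).
Proof. by move=> x y z; ring. Qed.
Lemma lmulDr : right_distributive (@lmul U R) (@ladd U R).
Proof. by move=> x y z; ring. Qed.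

End LineMonoid.

HB.instance Definition _ (U : cc_universe) (R : line U) :=
  Monoid.isComLaw.Build (pt R) l0 (@ladd U R) (@laddA U R) (@laddC U R)
    (@ladd0l U R).
HB.instance Definition _ (U : cc_universe) (R : line U) :=
  Monoid.isMulLaw.Build (pt R) l0 (@lmul U R) (@lmul0l U R) (@lmul0r U R).
HB.instance Definition _ (U : cc_universe) (R : line U) :=
  Monoid.isAddLaw.Build (pt R) (@lmul U R) (@ladd U R)
    (@lmulDl U R) (@lmulDr U R).

Notation word := (seq nat).

Fixpoint subwords (w : word) : seq word :=
  if w is a :: w' then map (cons a) (subwords w') ++ subwords w'
  else [:: [::]].

Lemma mem_subwords u w : (u \in subwords w) = subseq u w.
Proof.
elim: w u => [|a w IH] u; first by rewrite inE; case: u.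
rewrite [subwords _]/= mem_cat IH; case: u => [|b u] /=.
  by rewrite sub0seq orbT.
case: eqP => [-> | ne].
  rewrite mem_map ?IH; last by move=> ? ? [].
  by apply/orb_idr => /(subseq_trans (subseq_cons u a)).
by rewrite -[RHS]orFb; congr orb; apply/mapP => -[v _ [/ne]].
Qed.

(** Repeated letters are excluded so that letters have square zero: the shuffle of a with itself is
    2 aa. The empty word is excluded since these words form the basis of the augmentation ideal. *)
Definition lang (F : seq word) : seq word :=
  undup [seq u <- flatten (map subwords F) | (u != [::]) && uniq u].

Lemma mem_lang F u :
  (u \in lang F) = [&& u != [::], uniq u & has (subseq u) F].
Proof.
rewrite mem_undup mem_filter -andbA; congr [&& _, _ & _].
apply/flatten_mapP/hasP => -[w wF Hw]; exists w => //.
  by rewrite -mem_subwords.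
by rewrite mem_subwords.
Qed.

Lemma lang_uniq F : uniq (lang F). Proof. exact: undup_uniq. Qed.

Lemma lang_sub F u w : subseq u w -> w \in lang F -> u != [::] -> u \in lang F.
Proof.
move=> uw; rewrite !mem_lang => /and3P[_ w_uniq /hasP[v vF wv]] ->.
rewrite (subseq_uniq uw w_uniq) /=.
by apply/hasP; exists v => //; apply: subseq_trans wv.
Qed.

(* shuffles u v w is the multiplicity of w in the shuffle product of u and v *)
Fixpoint shuffles (u v w : word) : nat :=
  if w is a :: w' then
    ((if u is b :: u' then if a == b then shuffles u' v w' else 0 else 0) +
     (if v is b :: v' then if a == b then shuffles u v' w' else 0 else 0))%N
  else nilp u && nilp v.

Lemma shuffles_sub u v w : shuffles u v w != 0%N -> subseq u w && subseq v w.
Proof.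
elim: w u v => [|a w IH] u v; first by case: u v => [|??] [|??].
have lift x : subseq x w -> subseq x (a :: w).
  by move=> xw; apply: subseq_trans (subseq_cons w a).
rewrite [shuffles _ _ _]/= addn_eq0 negb_and => /orP[].
  case: u => [|b u] //; case: (a =P b) => [<-|//] /IH /andP[uw /lift ->].
  by rewrite andbT /= eqxx.
case: v => [|b v] //; case: (a =P b) => [<-|//] /IH /andP[/lift -> vw].
by rewrite /= eqxx.
Qed.

Section ShuffleAlgebra.
Variables (U : cc_universe) (R : line U).
Local Open Scope line_scope.
Add Ring line_ring_tac' : (line_ring R).

Fixpoint natR (n : nat) : R := if n is m.+1 then 1 + natR m else 0.

Lemma natRD m n : natR (m + n)%N = natR m + natR n.
Proof. by elim: m => [|m IH] /=; rewrite ?add0n ?addSn /= ?IH; ring. Qed.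

(* The shuffle product of f and g, seen as functionals on words. *)
Fixpoint conv (f g : word -> R) (w : word) : R :=
  if w is a :: w' then
    conv (fun u => f (a :: u)) g w' + conv f (fun u => g (a :: u)) w'
  else f [::] * g [::].

Lemma eq_conv f f' g g' w :
  (forall u, subseq u w -> f u = f' u) -> (forall u, subseq u w -> g u = g' u) ->
  conv f g w = conv f' g' w.
Proof.
elim: w f f' g g' => [|a w IH] f f' g g' Hf Hg /=; first by rewrite Hf ?Hg.
by congr (_ + _); apply: IH => u uw; rewrite ?Hf ?Hg //= ?eqxx //;
  apply: subseq_trans (subseq_cons _ _).
Qed.

Lemma convC f g w : conv f g w = conv g f w.
Proof.
elim: w f g => [|a w IH] f g /=; first by ring.
by rewrite IH [conv f _ _]IH; ring.
Qed.

Lemma convDl f f' g w : conv (fun u => f u + f' u) g w = conv f g w + conv f' g w.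
Proof. by elim: w f f' g => [|a w IH] f f' g /=; rewrite ?IH; ring. Qed.

Lemma convDr f g g' w : conv f (fun u => g u + g' u) w = conv f g w + conv f g' w.
Proof. by rewrite convC convDl !(convC f). Qed.

Lemma convZl c f g w : conv (fun u => c * f u) g w = c * conv f g w.
Proof. by elim: w f g => [|a w IH] f g /=; rewrite ?IH; ring. Qed.

Lemma conv0l g w : conv (fun=> 0) g w = 0.
Proof. by elim: w g => [|a w IH] g /=; rewrite ?IH; ring. Qed.

(** Removing the first letter is a derivation of the shuffle product, so associativity passes from
    shorter words by bilinearity. *)
Lemma convA f g h w : conv (conv f g) h w = conv f (conv g h) w.
Proof.
elim: w f g h => [|a w IH] f g h /=; first by ring.
by rewrite convDl convDr !IH; ring.
Qed.

Lemma conv_suml n (c : 'I_n -> R) (f : 'I_n -> word -> R) g w :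
  conv (fun u => \sum_(i < n) (c i * f i u)) g w =
  \sum_(i < n) (c i * conv (f i) g w).
Proof.
elim: n c f => [|n IH] c f.
  rewrite big_ord0 -[RHS](conv0l g w); apply: eq_conv => // u _.
  by rewrite big_ord0.
rewrite big_ord_recl /= -IH -convZl -convDl; apply: eq_conv => // u _.
by rewrite big_ord_recl.
Qed.

Definition delta (u w : word) : R := if w == u then 1 else 0.

Lemma delta_cons u a w :
  delta u (a :: w) =
  if u is b :: u' then if a == b then delta u' w else 0 else 0.
Proof.
by rewrite /delta; case: u => [|b u] //; rewrite eqseq_cons; case: (a == b).
Qed.

Lemma conv_delta u v w : conv (delta u) (delta v) w = natR (shuffles u v w).
Proof.
elim: w u v => [|a w IH] u v /=.
  by case: u v => [|??] [|??] //=; rewrite /delta /=; ring.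
rewrite natRD; congr (_ + _).
  case: u => [|b u]; first by rewrite -[RHS](conv0l (delta v) w); apply: eq_conv.
  case: (a =P b) => [-> | ne].
    by rewrite -IH; apply: eq_conv => // x _; rewrite delta_cons eqxx.
  rewrite -[RHS](conv0l (delta v) w); apply: eq_conv => // x _.
  by rewrite delta_cons; case: eqP ne.
rewrite convC; case: v => [|b v].
  by rewrite -[RHS](conv0l (delta u) w); apply: eq_conv.
case: (a =P b) => [-> | ne].
  by rewrite -IH convC; apply: eq_conv => // x _; rewrite delta_cons eqxx.
rewrite -[RHS](conv0l (delta u) w); apply: eq_conv => // x _.
by rewrite delta_cons; case: eqP ne.
Qed.

(** Splitting [w] into complementary subwords, the part read by [g] must be nonempty to contribute,
    which leaves at most [N] letters to [f]. *)
Lemma conv_eq0 N f g w :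
  (forall u, (size u <= N)%N -> f u = 0) -> g [::] = 0 -> (size w <= N.+1)%N ->
  conv f g w = 0.
Proof.
move=> Hf Hg; elim: w N f g Hf Hg => [|a w IH] N f g Hf Hg /= Hw.
  by rewrite Hg; ring.
have -> : conv f (fun u => g (a :: u)) w = 0.
  rewrite -[RHS](conv0l (fun u => g (a :: u)) w); apply: eq_conv => // u.
  by move=> /size_subseq Hu; apply: Hf; apply: leq_trans Hu Hw.
case: N => [|N] in Hf Hw *.
  by case: w Hw {IH} => //= _; rewrite Hg; ring.
by rewrite (IH N) //; [ring | move=> u Hu; apply: Hf].
Qed.

Variable F : seq word.
Local Notation L := (lang F).
Local Notation n := (size L).

Definition wd (i : 'I_n) : word := nth [::] L i.

Lemma wd_in i : wd i \in L. Proof. exact: mem_nth. Qed.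

Lemma wd_inj : injective wd.
Proof.
move=> i j /eqP; rewrite /wd nth_uniq ?lang_uniq // => /eqP.
exact: val_inj.
Qed.

Lemma wd_neq0 i : wd i != [::].
Proof. by have := wd_in i; rewrite mem_lang => /and3P[]. Qed.

(** Extension by zero to all words, so that products can be computed by [conv], which knows nothing
    of [F]. *)
Definition ext (c : 'I_n -> R) (w : word) : R :=
  \sum_(i < n) (c i * delta (wd i) w).

Lemma ext_wd c i : ext c (wd i) = c i.
Proof.
rewrite /ext (bigD1 i) //= big1 => [|j /eqP ne].
  by rewrite /delta eqxx; ring.
by rewrite /delta; case: eqP => [/wd_inj E|_]; [case: ne | ring].
Qed.

Lemma ext_notin c w : w \notin L -> ext c w = 0.
Proof.
move=> wL; rewrite /ext big1 // => i _; rewrite /delta.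
by case: eqP => [E|_]; [case/negP: wL; rewrite E wd_in | ring].
Qed.

Lemma wdP w : w \in L -> {i | w = wd i}.
Proof.
move=> wL; have lt : (index w L < n)%N by rewrite index_mem.
by exists (Ordinal lt); rewrite /wd nth_index.
Qed.

Lemma nil_notin : [::] \notin L. Proof. by rewrite mem_lang. Qed.

Definition shstr (i j k : 'I_n) : R := natR (shuffles (wd i) (wd j) (wd k)).

Lemma smul_conv u v k : smul shstr u v k = conv (ext u) (ext v) (wd k).
Proof.
rewrite conv_suml; apply: eq_bigr => i _.
rewrite convC conv_suml big_distrr; apply: eq_bigr => j _ /=.
rewrite /shstr -conv_delta [in RHS]convC.
by transitivity (u i * (v j * conv (delta (wd i)) (delta (wd j)) (wd k)));
  first ring.
Qed.

(** Outside [L] the left side is 0 while the right side need not be. Subwords of basis words suffice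
    for associativity, since [conv] reads its arguments at subwords only. *)
Lemma ext_smul u v w k :
  subseq w (wd k) -> ext (smul shstr u v) w = conv (ext u) (ext v) w.
Proof.
case: (w =P [::]) => [-> _ | /eqP w0 wk].
  by rewrite !ext_notin ?nil_notin //=; rewrite !ext_notin ?nil_notin //; ring.
by have [i ->] := wdP (lang_sub wk (wd_in k) w0); rewrite ext_wd smul_conv.
Qed.

Lemma shmulC u v k : smul shstr u v k = smul shstr v u k.
Proof. by rewrite !smul_conv convC. Qed.

Lemma shmulA u v w k :
  smul shstr u (smul shstr v w) k = smul shstr (smul shstr u v) w k.
Proof.
rewrite !smul_conv; transitivity (conv (ext u) (conv (ext v) (ext w)) (wd k)).
  by apply: eq_conv => // x /ext_smul.
by rewrite -convA; apply: eq_conv => // x /ext_smul.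
Qed.

Lemma shmul_nil : exists N, forall v k, smul_prod shstr v N k = 0.
Proof.
(* A product of [N.+2] elements of the ideal vanishes on words of at most [N.+1] letters. *)
suff H N v k : (size (wd k) <= N.+1)%N -> smul_prod shstr v N.+1 k = 0; last first.
  have prodS m : smul_prod shstr v m.+1 = smul shstr (smul_prod shstr v m) (v m.+1).
    by [].
  elim: N k => [|N IH] k Hk; rewrite prodS smul_conv.
    apply: (conv_eq0 (N := 0%N)) Hk; last by rewrite ext_notin ?nil_notin.
    by case=> // _; rewrite ext_notin ?nil_notin.
  apply: (conv_eq0 (N := N.+1)) Hk; last by rewrite ext_notin ?nil_notin.
  move=> u Hu; case: (boolP (u \in L)) => [/wdP[i E] | /ext_notin -> //].
  by rewrite E ext_wd IH // -E.
exists (\max_(w <- L) size w).+1 => v k; apply: H; apply: leqW.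
exact: (@leq_bigmax_seq _ L xpredT (fun w => size w) _ (wd_in k) isT).
Qed.

Definition shuffle_weil : weil R := Weil shmulC shmulA shmul_nil.

End ShuffleAlgebra.

(** * Points of shuffle algebras *)

Lemma coord_inj (U : cc_universe) (X : space U) n (x y : power X n) :
  (forall i, coord x i = coord y i) -> x = y.
Proof.
elim: n x y => [|n IH] x y H; first by rewrite (one_eta x) (one_eta y).
rewrite -(pair_eta x) -(pair_eta y); congr opair.
  by have := H ord0; rewrite /= unlift_none.
by apply: IH => i; have := H (lift ord0 i); rewrite /= liftK.
Qed.

Lemma eq_lam (U : cc_universe) (X Y : space U) (f g : X -> Y)
    (Hf : is_map f) (Hg : is_map g) :
  (forall x, f x = g x) -> lam f Hf = lam g Hg.
Proof. by move=> E; apply: app_ext => x; rewrite !app_lam. Qed.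

Section Points.
Variables (U : cc_universe) (R : line U).
Local Open Scope line_scope.
Add Ring line_ring_tac' : (line_ring R).

Definition Sp (F : seq word) : space U := Spec (shuffle_weil R F).

Lemma sum_wd F (f : word -> R) :
  \big[@ladd U R/l0]_(w <- lang F) f w = \sum_(i < size (lang F)) f (wd i).
Proof. by rewrite (big_nth [::]) big_mkord. Qed.

Lemma sum_lang_sub F' F (f : word -> R) :
  {subset lang F' <= lang F} -> (forall w, w \notin lang F' -> f w = 0) ->
  \big[@ladd U R/l0]_(w <- lang F) f w = \big[@ladd U R/l0]_(w <- lang F') f w.
Proof.
move=> FF Hf; rewrite (bigID (mem (lang F'))) /= [X in _ + X]big1; last first.
  by move=> w /Hf.
rewrite laddC ladd0l -big_filter; apply: perm_big.
apply: uniq_perm; rewrite ?filter_uniq ?lang_uniq // => w.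
by rewrite mem_filter; apply: andb_idr => /FF.
Qed.

Section Coordinates.
Variable F : seq word.
Local Notation L := (lang F).

Definition cw (x : Sp F) (w : word) : R := @ext U R F (coord (incl x)) w.

Lemma cw_wd x i : cw x (wd i) = coord (incl x) i.
Proof. exact: ext_wd. Qed.

Lemma cw_notin x w : w \notin L -> cw x w = 0.
Proof. exact: ext_notin. Qed.

(* f is a character of the shuffle algebra of F (with f [::] = 1 understood). *)
Definition is_char (f : word -> R) : Prop := forall u v, u \in L -> v \in L ->
  f u * f v = \big[@ladd U R/l0]_(w <- L) (natR R (shuffles u v w) * f w).

Lemma cw_char x : is_char (cw x).
Proof.
move=> _ _ /wdP[i ->] /wdP[j ->]; rewrite !cw_wd sum_wd.
have /(congr1 (fun y => coord (coord y i) j)) := incl_eq x.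
rewrite /spec_lhs /spec_rhs !coord_tup => ->; apply: eq_bigr => k _.
by rewrite cw_wd.
Qed.

Lemma mkpt_eq f : is_char f ->
  @spec_lhs U R (shuffle_weil R F) (tup (fun i => f (wd i))) =
  @spec_rhs U R (shuffle_weil R F) (tup (fun i => f (wd i))).
Proof.
move=> Hf; apply: coord_inj => i; apply: coord_inj => j.
rewrite /spec_lhs /spec_rhs !coord_tup Hf ?wd_in // sum_wd.
by apply: eq_bigr => k _; rewrite coord_tup.
Qed.

Definition mkpt f (Hf : is_char f) : Sp F := elem _ (mkpt_eq Hf).

Lemma cw_mkpt f (Hf : is_char f) w : w \in L -> cw (mkpt Hf) w = f w.
Proof. by move=> /wdP[i ->]; rewrite cw_wd incl_elem coord_tup. Qed.

Lemma map_mkpt (Z : space U) (f : Z -> word -> R) (Hf : forall z, is_char (f z)) :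
  (forall w, w \in L -> is_map (fun z => f z w)) ->
  is_map (fun z => mkpt (Hf z)).
Proof.
move=> map_f; refine (@map_elem _ _ _ _ _ _ _ _ _ (fun z => mkpt_eq (Hf z)) _).
by apply: map_tup => i; apply: map_f; apply: wd_in.
Qed.

Lemma cw_inj x y : (forall w, w \in L -> cw x w = cw y w) -> x = y.
Proof.
move=> H; apply: incl_inj; apply: coord_inj => i.
by rewrite -!cw_wd H ?wd_in.
Qed.

Lemma map_cw (Z : space U) (x : Z -> Sp F) w :
  is_map x -> is_map (fun z => cw (x z) w).
Proof. by move=> Hx; rewrite /cw /ext; map_tac. Qed.

(** The only word in the shuffle of a with itself is aa, which repeats a letter. *)
Lemma shuffles_letter a w : uniq w -> shuffles [:: a] [:: a] w = 0%N.
Proof.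
case: w => [|b [|c [|e w]]] //=; first by case: (b == a).
  rewrite inE andbT; case: (b =P a) => [->|_] //; rewrite eq_sym.
  by move/negPf->.
by case: (b == a); case: (c == a).
Qed.

Lemma cw_sq x a : cw x [:: a] * cw x [:: a] = 0.
Proof.
have [aL|/cw_notin ->] := boolP ([:: a] \in L); last by ring.
rewrite cw_char // big1_seq // => w /andP[_].
by rewrite mem_lang => /and3P[_ Hw _]; rewrite shuffles_letter //=; ring.
Qed.

Definition letter a (x : Sp F) : D R := elem (cw x [:: a]) (cw_sq x a).

Lemma map_letter (Z : space U) (x : Z -> Sp F) a :
  is_map x -> is_map (fun z => letter a (x z)).
Proof. by move=> Hx; apply: map_elem; apply: map_cw. Qed.

Lemma incl_letter a x : incl (letter a x) = cw x [:: a].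
Proof. exact: incl_elem. Qed.

End Coordinates.

Definition subl (F' F : seq word) : bool := all (mem (lang F)) (lang F').

Lemma sublP F' F : reflect {subset lang F' <= lang F} (subl F' F).
Proof. exact: allP. Qed.

Lemma subl_facets F' F : {subset F' <= F} -> subl F' F.
Proof.
move=> FF; apply/sublP => w; rewrite !mem_lang => /and3P[-> -> /hasP[v vF wv]].
by apply/hasP; exists v; rewrite // FF.
Qed.

(** Extension by zero preserves characters: the shuffle of a word outside [lang F'] with any word
    has only words outside [lang F'], as languages are closed under nonempty subwords. *)
Lemma char_sub F' F (x : Sp F') : subl F' F -> is_char F (cw x).
Proof.
move=> /sublP FF u v uF vF; have [uF'|uF'] := boolP (u \in lang F'); last first.
  rewrite cw_notin // big1_seq => [|w /andP[_ wF]]; first by ring.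
  have [wF'|/cw_notin ->] := boolP (w \in lang F'); last by ring.
  have [->|/shuffles_sub/andP[uw _]] := eqVneq (shuffles u v w) 0%N.
    by rewrite /=; ring.
  case/negP: uF'; apply: lang_sub uw wF' _.
  by move: uF; rewrite mem_lang => /and3P[].
have [vF'|vF'] := boolP (v \in lang F'); last first.
  rewrite (cw_notin _ vF') big1_seq => [|w /andP[_ wF]]; first by ring.
  have [wF'|/cw_notin ->] := boolP (w \in lang F'); last by ring.
  have [->|/shuffles_sub/andP[_ vw]] := eqVneq (shuffles u v w) 0%N.
    by rewrite /=; ring.
  case/negP: vF'; apply: lang_sub vw wF' _.
  by move: vF; rewrite mem_lang => /and3P[].
rewrite cw_char // [RHS](sum_lang_sub FF) // => w /cw_notin ->; ring.
Qed.

Lemma iota_char F' F (x : Sp F') :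
  is_char F (fun w => if subl F' F then cw x w else 0).
Proof.
case: (boolP (subl F' F)) => [|_]; first exact: char_sub.
by move=> u v _ _; rewrite big1 => [|w _]; ring.
Qed.

(* The point 0 is a junk value, for F' not included in F. *)
Definition iota_fun F' F (x : Sp F') : Sp F := mkpt (@iota_char F' F x).

Lemma map_iota F' F : is_map (@iota_fun F' F).
Proof.
apply: map_mkpt => w _; case: (subl F' F); last exact: map_const.
by apply: (map_cw (x := id)); apply: Defs.map_id.
Qed.

Definition inc F' F : Sp F' ~> Sp F := lam _ (map_iota F' F).

Lemma cw_inc F' F x w : subl F' F -> cw (inc F' F x) w = cw x w.
Proof.
move=> FF; rewrite app_lam; have [wF|wF] := boolP (w \in lang F).
  by rewrite cw_mkpt // FF.
by rewrite !cw_notin //; apply: contra wF => /(sublP _ _ FF).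
Qed.

Lemma subl_trans F1 F2 F3 : subl F1 F2 -> subl F2 F3 -> subl F1 F3.
Proof. by move=> /sublP H1 /sublP H2; apply/sublP => w /H1/H2. Qed.

Lemma inc_inc F1 F2 F3 x : subl F1 F2 -> subl F2 F3 ->
  inc F2 F3 (inc F1 F2 x) = inc F1 F3 x.
Proof.
move=> H12 H23; apply: cw_inj => w wF.
by rewrite !cw_inc //; apply: subl_trans H23.
Qed.

Lemma letter_inc F' F a x : subl F' F -> letter a (inc F' F x) = letter a x.
Proof. by move=> H; apply: incl_inj; rewrite !incl_letter cw_inc. Qed.

(** All common subwords are listed as facets, not only the maximal ones; this is harmless, as the
    spectrum depends on the facets through [lang] alone. *)
Definition meet (v w : word) : seq word :=
  [seq u <- lang [:: v] | u \in lang [:: w]].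

Lemma lang_meet v w u :
  (u \in lang (meet v w)) = (u \in lang [:: v]) && (u \in lang [:: w]).
Proof.
rewrite [in LHS]mem_lang; apply/and3P/andP => [[u0 uu /hasP[t]]|[uv uw]].
  by rewrite mem_filter => /andP[tw tv] ut; split; apply: lang_sub ut _ u0.
have := uv; rewrite mem_lang => /and3P[-> -> _]; split=> //.
by apply/hasP; exists u; rewrite // mem_filter uv uw.
Qed.

Lemma subl_meetl v w : subl (meet v w) [:: v].
Proof. by apply/sublP => u; rewrite lang_meet => /andP[]. Qed.

Lemma subl_meetr v w : subl (meet v w) [:: w].
Proof. by apply/sublP => u; rewrite lang_meet => /andP[]. Qed.

End Points.

(** * Gluing along facets *)

Section KockLawvere.
Variables (U : cc_universe) (R : line U).
Local Open Scope line_scope.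
Add Ring line_ring_tac' : (line_ring R).

(* c [::] is the value at 0. *)
Definition expansion F (c : word -> R) (x : Sp R F) : R :=
  c [::] + \big[@ladd U R/l0]_(w <- lang F) (c w * cw x w).

Lemma expansion_inc F' F c x : subl F' F ->
  expansion c (inc R F' F x) = expansion c x.
Proof.
move=> FF; congr (_ + _); rewrite (sum_lang_sub (sublP _ _ FF)) => [|w wF].
  by apply: eq_bigr => w _; rewrite cw_inc.
by rewrite cw_inc // cw_notin //; ring.
Qed.

Lemma eq_expansion F (c c' : word -> R) (x : Sp R F) :
  {in [::] :: lang F, c =1 c'} -> expansion c x = expansion c' x.
Proof.
move=> E; congr (_ + _); first by rewrite E ?mem_head.
by apply: eq_big_seq => w wF; rewrite E // inE wF orbT.
Qed.

Lemma map_bigsum (Z : space U) (s : seq word) (f : Z -> word -> R) :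
  (forall w, is_map (fun z => f z w)) ->
  is_map (fun z => \big[@ladd U R/l0]_(w <- s) f z w).
Proof.
move=> Hf; elim: s => [|w s IH].
  by apply: map_ext (map_const _ _) => z; rewrite big_nil.
by apply: map_ext (map_add (Hf w) IH) => z; rewrite big_cons.
Qed.

(** Coefficients are indexed by words rather than basis positions, so that those of different facets
    can be compared. *)
Definition is_coef F (co : (Sp R F ~> R) -> word -> R) : Prop :=
  [/\ forall (phi : Sp R F ~> R) x, phi x = expansion (co phi) x,
      forall w, is_map (fun phi : Sp R F ~> R => co phi w) &
      forall c c', (forall x : Sp R F, expansion c x = expansion c' x) ->
        {in [::] :: lang F, c =1 c'}].

Lemma kl_coef (KL : kock_lawvere R) F : exists co, @is_coef F co.
Proof.
have [g [gK Kg]] := KL (shuffle_weil R F).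
have expE (v : wspace (shuffle_weil R F)) (c : word -> R) x :
    pr1 v = c [::] -> (forall i, coord (pr2 v) i = c (wd i)) ->
    canonical (shuffle_weil R F) v x = expansion c x.
  move=> c0 ci; rewrite /canonical !app_lam /weval c0 /expansion sum_wd.
  by congr (_ + _); apply: eq_bigr => i _; rewrite cw_wd ci.
exists (fun phi w =>
  if w == [::] then pr1 (g phi) else @ext U R F (coord (pr2 (g phi))) w); split.
- move=> phi x; rewrite -{1}[phi]Kg; apply: expE => [|i] //.
  by rewrite ext_wd (negPf (wd_neq0 _)).
- by move=> w; case: eqP => _; rewrite /ext; map_tac.
move=> c c' E w.
pose v c : wspace (shuffle_weil R F) := opair (c [::]) (tup (fun i => c (wd i))).
have : v c = v c'.
  rewrite -[LHS]gK -[RHS]gK; congr (g _); apply: app_ext => x.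
  rewrite (expE _ c) ?(expE _ c') /v ?pr1_pair ?pr2_pair // => i;
  by rewrite coord_tup.
rewrite inE => Ev /predU1P[->|/wdP[i ->]].
  by have := congr1 pr1 Ev; rewrite !pr1_pair.
have := congr1 (fun v => coord (pr2 v) i) Ev.
by rewrite !pr2_pair !coord_tup.
Qed.

Section Facets.
Variable F : seq word.
Local Notation N := (size F).
Local Notation T := ('I_N * 'I_N)%type.

Definition facet (i : 'I_N) : word := nth [::] F i.
Definition overlap (t : T) : seq word := meet (facet t.1) (facet t.2).

Lemma subl_facet i : subl [:: facet i] F.
Proof. by apply: subl_facets => w; rewrite inE => /eqP->; apply: mem_nth. Qed.

Lemma subl_overlap t : subl (overlap t) F.
Proof. exact: subl_trans (subl_meetl _ _) (subl_facet _). Qed.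

(** The arrow (t, b) includes the overlap t in its first or second facet, according to b. *)
Definition fsrc (a : 'I_#|{: T * bool}|) : 'I_#|{: T}| := enum_rank (enum_val a).1.

Definition ftgt (a : 'I_#|{: T * bool}|) : 'I_#|{: T}| :=
  let t := (enum_val a).1 in
  enum_rank (if (enum_val a).2 then (t.1, t.1) else (t.2, t.2)).

Lemma subl_arr a : subl (overlap (enum_val (fsrc a))) (overlap (enum_val (ftgt a))).
Proof.
rewrite !enum_rankK; apply/sublP => w; rewrite /overlap.
by case: ifP => _ /=; rewrite !lang_meet andbb => /andP[].
Qed.

Lemma facet_cocone_eq a x :
  inc R (overlap (enum_val (ftgt a))) F
    (inc R (overlap (enum_val (fsrc a))) (overlap (enum_val (ftgt a))) x) =
  inc R (overlap (enum_val (fsrc a))) F x.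
Proof. by rewrite inc_inc ?subl_arr ?subl_overlap. Qed.

(* The points of F as a gluing of those of its facets along their pairwise    *)
(* intersections; the facet i occurs as the intersection with itself.         *)
Definition facet_cocone : cocone R :=
  @Cocone U R _ _ (fun k => shuffle_weil R (overlap (enum_val k))) fsrc ftgt
    (fun a => inc R _ _) (shuffle_weil R F)
    (fun k => inc R (overlap (enum_val k)) F) facet_cocone_eq.

(** A compatible family amounts to coefficients on the languages of the facets that agree on the
    intersections, hence to coefficients on their union [lang F]. *)
Lemma facet_limit (KL : kock_lawvere R) : F != [::] -> limit_under facet_cocone R.
Proof.
rewrite -size_eq0 -lt0n => N_gt0 Z g /= Hg.
have [co Hco] := fin_all_exists
  (fun k : 'I_#|{: T}| => kl_coef KL (overlap (enum_val k))).
pose a k z w := co k (g k z) w.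
have a_arr b z : {in [::] :: lang (overlap (enum_val (fsrc b))),
    a (ftgt b) z =1 a (fsrc b) z}.
  have [_ _ uniq_co] := Hco (fsrc b); refine (uniq_co _ _ _) => x.
  have [Es _ _] := Hco (fsrc b); have [Et _ _] := Hco (ftgt b).
  by rewrite -(expansion_inc _ _ (subl_arr b)) -Es -Et Hg.
pose d i : 'I_#|{: T}| := enum_rank (i, i).
have a_diag k z w : w \in [::] :: lang (overlap (enum_val k)) ->
    a k z w = a (d (enum_val k).1) z w /\ a k z w = a (d (enum_val k).2) z w.
  have Ek b : fsrc (enum_rank (enum_val k, b)) = k.
    by rewrite /fsrc enum_rankK enum_valK.
  have Ed (b : bool) : ftgt (enum_rank (enum_val k, b)) =
      d (if b then (enum_val k).1 else (enum_val k).2).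
    by rewrite /ftgt enum_rankK; case: b.
  move=> wk; have := a_arr (enum_rank (enum_val k, true)) z w.
  have := a_arr (enum_rank (enum_val k, false)) z w.
  by rewrite !Ek !Ed => -> // ->.
pose i0 := Ordinal N_gt0.
(* The default [i0] serves the empty word, which is in no language; all facets share its
   coefficient, the value at 0. *)
pose iw w := odflt i0 [pick i | w \in lang [:: facet i]].
pose c z w := a (d (iw w)) z w.
have a_c k z : {in [::] :: lang (overlap (enum_val k)), a k z =1 c z}.
  move=> w wk; have [-> _] := a_diag _ z _ wk; rewrite /c.
  set i := (enum_val k).1.
  have wi j : w \in [::] :: lang [:: facet i] -> w \in [::] :: lang [:: facet j] ->
      a (d i) z w = a (d j) z w.
    rewrite !inE => Hi Hj; have [] := a_diag (enum_rank (i, j)) z w.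
      by rewrite enum_rankK inE lang_meet orb_andr Hi Hj.
    by rewrite enum_rankK /= => -> ->.
  have Hi : w \in [::] :: lang [:: facet i].
    by move: wk; rewrite !inE lang_meet => /orP[->|/andP[-> _]]; rewrite ?orbT.
  apply: wi => //; rewrite /iw; case: pickP => [j|/(_ i)] /=.
    by rewrite inE => ->; rewrite orbT.
  by move: Hi; rewrite !inE => /orP[-> //|->].
have map_h2 : is_map (fun z : times Z (Sp R F) => expansion (c (pr1 z)) (pr2 z)).
  have map_c w : is_map (fun z : times Z (Sp R F) => c (pr1 z) w).
    have [_ /(_ w) map_co _] := Hco (d (iw w)).
    apply: (Defs.map_comp (f := fun z => g (d (iw w)) (pr1 z))) map_co.
    by map_tac.
  apply: map_add => //; apply: map_bigsum => w; apply: map_mul => //.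
  by apply: map_cw; apply: map_pr2.
have map_h z : is_map (@expansion F (c z)).
  apply: map_add; first exact: map_const.
  apply: map_bigsum => w; apply: map_mul; first exact: map_const.
  by apply: (map_cw (x := id)); apply: Defs.map_id.
pose h := lam (fun z => lam (@expansion F (c z)) (map_h z)) (map_curry _ map_h2).
have hE z x : h z x = expansion (c z) x by rewrite !app_lam.
exists h; split=> [k z x|h' Hh'].
  rewrite hE; transitivity (@expansion (overlap (enum_val k)) (c z) x).
    exact: expansion_inc (subl_overlap _).
  have [-> _ _] := Hco k; apply: eq_expansion => w wk.
  by rewrite -(a_c k).
apply: app_ext => z; apply: app_ext => x; rewrite hE.
have [coF [EF _ _]] := kl_coef KL F; rewrite EF.
have cE k : {in [::] :: lang (overlap (enum_val k)), coF (h' z) =1 a k z}.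
  have [Ek _ uniq_co] := Hco k; refine (uniq_co _ _ _) => y.
  rewrite -(expansion_inc _ _ (subl_overlap (enum_val k))) -EF.
  by rewrite -[RHS]Ek; apply: Hh'.
apply: eq_expansion => w; rewrite inE => /predU1P[->|wF].
  by rewrite /c (cE (d (iw [::]))) // mem_head.
have := wF; rewrite mem_lang => /and3P[w0 wu /(has_nthP [::])[i iN wi]].
have wi' : w \in lang [:: facet (Ordinal iN)] by rewrite mem_lang w0 wu /= wi.
rewrite (cE (d (Ordinal iN))); last by rewrite inE enum_rankK lang_meet wi' orbT.
by rewrite a_c // inE enum_rankK lang_meet wi' orbT.
Qed.

End Facets.

(** Microlinearity applied to [facet_limit], with the terminal space as space of parameters. *)
Lemma glue (KL : kock_lawvere R) X (HX : microlinear R X) (F : seq word)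
    (g : forall w, Sp R [:: w] ~> X) : F != [::] ->
  (forall v w, v \in F -> w \in F -> forall x : Sp R (meet v w),
    g v (inc R _ _ x) = g w (inc R _ _ x)) ->
  exists! h : Sp R F ~> X, forall w, w \in F -> forall x : Sp R [:: w],
    h (inc R _ _ x) = g w x.
Proof.
move=> F0 Hg.
pose G (k : 'I_#|{: 'I_(size F) * 'I_(size F)}|) :
    @Defs.one U ~> Sp R (overlap (enum_val k)) ~> X :=
  mlam (fun u : @Defs.one U => mlam (fun x : Sp R (overlap (enum_val k)) =>
    g (facet (F := F) (enum_val k).1) (inc R _ _ x))).
have facetF i : facet (F := F) i \in F by apply: mem_nth.
have GE k u x : G k u x = g _ (inc R _ [:: facet (enum_val k).1] x).
  by rewrite !app_lam.
have g_eq (t : 'I_(size F) * 'I_(size F)) i (x : Sp R (overlap t)) :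
    i = t.1 \/ i = t.2 ->
    g (facet i) (inc R _ _ x) = g (facet t.1) (inc R _ _ x).
  by case=> ->; rewrite // -[LHS](Hg (facet t.1) (facet t.2)).
have [a z x|h [Hh uniq_h]] := HX _ (facet_limit KL F0) (@Defs.one U) G.
  rewrite !GE inc_inc ?subl_arr ?subl_meetl //; apply: g_eq.
  by rewrite /fsrc /ftgt !enum_rankK; case: ifP; [left|right].
exists (h star); split=> [w wF x|h' Hh'].
  have iN : (index w F < size F)%N by rewrite index_mem.
  pose k := enum_rank (Ordinal iN, Ordinal iN).
  have E : facet (F := F) (enum_val k).1 = w.
    by rewrite enum_rankK /facet nth_index.
  have wk : subl [:: w] (overlap (enum_val k)).
    apply/sublP => u; rewrite lang_meet E enum_rankK /= /facet nth_index //.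
    by rewrite andbb.
  have := Hh k star (inc R _ _ x).
  rewrite GE !inc_inc ?subl_overlap ?subl_meetl // => ->.
  by rewrite E; congr (g w _); apply: cw_inj => u uw; rewrite cw_inc //; apply/sublP.
suff <- : mlam (fun u : @Defs.one U => h') = h by rewrite app_lam.
symmetry; apply: uniq_h => k u x; rewrite app_lam GE -Hh' ?facetF // inc_inc //.
  exact: subl_meetl.
exact: subl_facet.
Qed.

End KockLawvere.

(** * Gluing in terms of the supports of points *)

Section GlueOn.
Variables (U : cc_universe) (R : line U).
Local Open Scope line_scope.
Add Ring line_ring_tac'' : (line_ring R).

(** The point lies on the part of the spectrum spanned by [F'] ([supported_inc]). With overlaps
    expressed this way, all maps to be glued live on the same space [Sp R F]. *)
Definition supported F (F' : seq word) (y : Sp R F) : Prop :=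
  forall w, w \in lang F -> w \notin lang F' -> cw y w = 0.

Lemma supported_inc F' F (y : Sp R F) : subl F' F -> supported F' y ->
  exists x, inc R F' F x = y.
Proof.
move=> FF y_supp; have FP := sublP _ _ FF.
have Hy : is_char F' (cw y).
  move=> u v uF vF; rewrite cw_char ?FP //.
  pose f w := if w \in lang F' then natR R (shuffles u v w) * cw y w else 0.
  transitivity (\big[@ladd U R/l0]_(w <- lang F) f w).
    apply: eq_big_seq => w wF; rewrite /f; case: ifPn => // wF'.
    by rewrite y_supp //; ring.
  rewrite (sum_lang_sub FP) => [|w /negPf wF']; last by rewrite /f wF'.
  by apply: eq_big_seq => w wF; rewrite /f wF.
exists (mkpt Hy); apply: cw_inj => w wF; rewrite cw_inc //.
have [wF'|wF'] := boolP (w \in lang F'); first by rewrite cw_mkpt.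
by rewrite cw_notin // y_supp.
Qed.

Lemma inc_supported F' F x : subl F' F -> supported F' (inc R F' F x).
Proof. by move=> FF w _ wF'; rewrite cw_inc // cw_notin. Qed.

Lemma glue_on (KL : kock_lawvere R) X (HX : microlinear R X) (F : seq word)
    (g : word -> Sp R F ~> X) : F != [::] ->
  (forall v w, v \in F -> w \in F -> forall y : Sp R F,
    supported (meet v w) y -> g v y = g w y) ->
  exists! h : Sp R F ~> X, forall w, w \in F -> forall y : Sp R F,
    supported [:: w] y -> h y = g w y.
Proof.
move=> F0 Hg.
pose g' w : Sp R [:: w] ~> X := mlam (fun x : Sp R [:: w] => g w (inc R _ F x)).
have sub1 w : w \in F -> subl [:: w] F.
  by move=> wF; apply: subl_facets => u; rewrite inE => /eqP->.
have g'E w x : g' w x = g w (inc R _ F x) by rewrite {1}/g' app_lam.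
have [v w vF wF x|h [Hh uniq_h]] := glue KL HX (g := g') F0.
  rewrite !g'E !inc_inc ?subl_meetl ?subl_meetr ?sub1 //; apply: Hg => //.
  by apply: inc_supported; apply: subl_trans (subl_meetl _ _) (sub1 _ vF).
exists h; split=> [w wF y|k Hk].
  by move=> /(supported_inc (sub1 _ wF))[x <-]; rewrite Hh // g'E.
apply: uniq_h => w wF x; rewrite g'E (Hk w wF) //; apply: inc_supported; exact: sub1.
Qed.

Lemma eq_on_facets (KL : kock_lawvere R) X (HX : microlinear R X) (F : seq word)
    (h k : Sp R F ~> X) : F != [::] ->
  (forall w, w \in F -> forall y, supported [:: w] y -> h y = k y) -> h = k.
Proof.
move=> F0 hk; have [//|l [_ uniq_l]] := glue_on KL HX (g := fun=> h) F0.
by rewrite -(uniq_l h) // (uniq_l k) // => w wF y /(hk w wF).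
Qed.

End GlueOn.

(** * The objects D(2) and D21 *)

(** Currying: a family of maps to [Y ~> X] with parameters in [Z] is a family of maps to [X] with
    parameters in [times Z Y]. *)
Lemma microlinear_expo (U : cc_universe) (R : line U) (X Y : space U) :
  microlinear R X -> microlinear R (Y ~> X).
Proof.
move=> HX C HC Z g Hg.
pose g' i : times Z Y ~> Spec (obj i) ~> X :=
  mlam (fun u : times Z Y => mlam (fun x : Spec (@obj _ R C i) =>
    g i (pr1 u) x (pr2 u))).
have g'E i z y x : g' i (opair z y) x = g i z x y.
  by rewrite !app_lam pr1_pair pr2_pair.
have [a u x|h' [Hh' uniq_h']] := HX C HC (times Z Y) g'.
  by rewrite -(pair_eta u) !g'E Hg.
pose h : Z ~> Spec (vertex C) ~> Y ~> X :=
  mlam (fun z : Z => mlam (fun x : Spec (vertex C) => mlam (fun y : Y =>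
    h' (opair z y) x))).
have hE z x y : h z x y = h' (opair z y) x by rewrite !app_lam.
exists h; split=> [i z x|k Hk]; first by apply: app_ext => y; rewrite hE Hh' g'E.
pose k' : times Z Y ~> Spec (vertex C) ~> X :=
  mlam (fun u : times Z Y => mlam (fun x : Spec (vertex C) => k (pr1 u) x (pr2 u))).
have k'E z y x : k' (opair z y) x = k z x y.
  by rewrite !app_lam pr1_pair pr2_pair.
have E : h' = k' by apply: uniq_h' => i u x; rewrite -(pair_eta u) k'E g'E Hk.
by apply: app_ext => z; apply: app_ext => x; apply: app_ext => y; rewrite hE E k'E.
Qed.

Lemma shufflesC u v w : shuffles u v w = shuffles v u w.
Proof.
elim: w u v => [|a w IH] u v /=; first by rewrite andbC.
by rewrite addnC; congr (_ + _)%N;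
  [case: v => [|b v] //; rewrite IH | case: u => [|b u] //; rewrite IH].
Qed.

(** * Finite tables of coefficients, checked by computation *)

Fixpoint all_prop (T : Type) (P : T -> Prop) (s : seq T) : Prop :=
  if s is x :: s' then P x /\ all_prop P s' else True.

Fixpoint all_pairs (T : Type) (P : T -> T -> Prop) (s : seq T) : Prop :=
  if s is x :: s' then all_prop (P x) s /\ all_pairs P s' else True.

Lemma all_propP (T : eqType) (P : T -> Prop) s :
  all_prop P s -> forall x, x \in s -> P x.
Proof.
by elim: s => [|y s IH] //= [Py Hs] x; rewrite inE => /predU1P[->|/IH]; auto.
Qed.

Lemma all_pairsP (T : eqType) (P : T -> T -> Prop) s :
  (forall x y, P x y -> P y x) -> all_pairs P s ->
  forall x y, x \in s -> y \in s -> P x y.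
Proof.
move=> symP; elim: s => [|z s IH] // [/all_propP Pz /IH Hs] x y.
rewrite !inE => /predU1P[->|xs] /predU1P[->|ys]; last exact: Hs.
- by apply: Pz; rewrite mem_head.
- by apply: Pz; rewrite inE ys orbT.
by apply: symP; apply: Pz; rewrite inE xs orbT.
Qed.

Section Tables.
Variables (U : cc_universe) (R : line U).
Local Open Scope line_scope.
Add Ring line_ring_tac' : (line_ring R).

Fixpoint lookup (s : seq (word * R)) (w : word) : R :=
  if s is (k, c) :: s' then if w == k then c else lookup s' w else 0.

(** Multiplicities 0 and 1 leave no trace, so that evaluation yields short polynomials. *)
Fixpoint shuffle_sum u v (f : word -> R) (s : seq word) : R :=
  if s is w :: s' then
    match shuffles u v w with
    | 0 => shuffle_sum u v f s'
    | 1 => f w + shuffle_sum u v f s'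
    | m => natR R m * f w + shuffle_sum u v f s'
    end
  else 0.

Lemma shuffle_sumE u v f s :
  \big[@ladd U R/l0]_(w <- s) (natR R (shuffles u v w) * f w) =
  shuffle_sum u v f s.
Proof.
elim: s => [|w s IH]; first by rewrite big_nil.
by rewrite big_cons IH /=; case: (shuffles u v w) => [|[|m]] /=; ring.
Qed.

Lemma is_char_pairs F L f : lang F = L ->
  all_pairs (fun u v => f u * f v = shuffle_sum u v f L) L -> is_char F f.
Proof.
move=> <- Hf u v uL vL; rewrite shuffle_sumE.
apply: all_pairsP Hf u v uL vL => u v; rewrite -!shuffle_sumE => E.
transitivity (f u * f v); [ring | rewrite E].
by apply: eq_bigr => w _; rewrite shufflesC.
Qed.

End Tables.

Ltac split_all := repeat match goal with
  | |- _ /\ _ => split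
  | |- True => exact I
  | |- _ -> _ => intro
  end.

(** Leaves one polynomial identity for each unordered pair of words. The operations of the line stay
    folded for [ring] to recognize them. *)
Ltac char_tac F :=
  let L := eval vm_compute in (lang F) in
  apply: (@is_char_pairs _ _ F L); [by vm_compute |];
  cbv -[ladd lmul lopp l0 l1 line_space pt]; split_all.

Definition words2 : seq word := [:: [:: 0]; [:: 1]]%N.
Definition perms2 : seq word := [:: [:: 0; 1]; [:: 1; 0]]%N.

Section Infinitesimals.
Variables (U : cc_universe) (R : line U).
Local Open Scope line_scope.
Add Ring line_ring_tac' : (line_ring R).
Local Notation "x - y" := (x + lopp 1 * y) : line_scope.

Lemma cw_mul F L u v (x : Sp R F) : lang F = L -> u \in L -> v \in L ->
  cw x u * cw x v = shuffle_sum u v (cw x) L.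
Proof. by move=> <- uL vL; rewrite cw_char // shuffle_sumE. Qed.

Lemma supported_tab F F' L (f : word -> R) (Hf : is_char F f) : lang F = L ->
  all_prop (fun w => if w \in lang F' then True else f w = 0) L ->
  supported F' (mkpt Hf).
Proof.
move=> <- /all_propP H w wF wF'; rewrite cw_mkpt //.
by have := H w wF; rewrite (negPf wF').
Qed.

Lemma letter_mkpt F (f : word -> R) (Hf : is_char F f) a : [:: a] \in lang F ->
  incl (letter a (mkpt Hf)) = f [:: a].
Proof. by move=> aF; rewrite incl_letter cw_mkpt. Qed.

Local Notation D := (D R).
Local Notation D2 := (D2 R).
Local Notation D21 := (D21 R).

Lemma D_inj (d e : D) : incl d = incl e -> d = e. Proof. exact: incl_inj. Qed.

Lemma incl_D0 : incl (D0 R) = 0. Proof. exact: incl_elem. Qed.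

Lemma letter_supp F F' a (y : Sp R F) : supported F' y -> [:: a] \notin lang F' ->
  letter a y = D0 R.
Proof.
move=> y_supp aF'; apply: D_inj; rewrite incl_letter incl_D0.
by have [/y_supp->|/cw_notin->] := boolP ([:: a] \in lang F).
Qed.

Lemma D2_mul (x : D2) : incl (pr1 (incl x)) * incl (pr2 (incl x)) = 0.
Proof. exact: (incl_eq x). Qed.

Definition D2_tab (x : D2) :=
  [:: ([:: 0%N], incl (pr1 (incl x))); ([:: 1%N], incl (pr2 (incl x)))].

Lemma D2_char x : is_char words2 (lookup (D2_tab x)).
Proof.
rewrite /D2_tab; move: (D_eq (pr1 (incl x))) (D_eq (pr2 (incl x))) (D2_mul x).
move: (incl _) (incl (pr2 _)) => d e Hd He Hde.
by char_tac words2; ring [Hd He Hde].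
Qed.

Definition D2_pt (x : D2) : Sp R words2 := mkpt (D2_char x).

Lemma pt_D2_eq (y : Sp R words2) :
  let z := opair (letter 0 y) (letter 1 y) in incl (pr1 z) * incl (pr2 z) = 0.
Proof.
rewrite /= pr1_pair pr2_pair !incl_letter.
by rewrite (cw_mul (L := [:: [:: 0]; [:: 1]]%N)).
Qed.
Definition pt_D2 (y : Sp R words2) : D2 := elem _ (pt_D2_eq y).

Lemma D2_ptK x : pt_D2 (D2_pt x) = x.
Proof.
apply: incl_inj; rewrite incl_elem -[RHS]pair_eta.
by congr opair; apply: D_inj; rewrite letter_mkpt.
Qed.

Lemma map_pt_D2 : is_map pt_D2.
Proof.
apply: map_elem; apply: map_pair; apply: map_letter; exact: Defs.map_id.
Qed.

Lemma D21_mul (x : D21) :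
  incl (pr1 (pr1 (incl x))) * incl (pr2 (incl x)) = 0 /\
  incl (pr2 (pr1 (incl x))) * incl (pr2 (incl x)) = 0.
Proof.
have := incl_eq x; rewrite /D21_lhs => E.
by have := congr1 pr1 E; have := congr1 pr2 E; rewrite !pr1_pair !pr2_pair.
Qed.

(** Coefficients of (1 + d1 X0)(1 + d2 X1)(1 + e [X1, X0]): the facet 01 is e = 0, and the facet 10
    is e = d1 d2. *)
Definition D21_tab (x : D21) :=
  let d1 := incl (pr1 (pr1 (incl x))) in let d2 := incl (pr2 (pr1 (incl x))) in
  let e := incl (pr2 (incl x)) in
  [:: ([:: 0%N], d1); ([:: 1%N], d2); ([:: 0%N; 1%N], d1 * d2 - e);
      ([:: 1%N; 0%N], e)].

Lemma D21_char x : is_char perms2 (lookup (D21_tab x)).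
Proof.
rewrite /D21_tab; move: (D_eq (pr1 (pr1 (incl x)))) (D_eq (pr2 (pr1 (incl x)))).
move: (D_eq (pr2 (incl x))) (D21_mul x).
move: (incl (pr1 _)) (incl (pr2 (pr1 _))) (incl (pr2 _)) => d1 d2 e He [].
move=> H1e H2e H1 H2.
by char_tac perms2; ring [He H1 H2 H1e H2e].
Qed.

Definition D21_pt (x : D21) : Sp R perms2 := mkpt (D21_char x).

Lemma map_D21_pt : is_map D21_pt.
Proof. by apply: map_mkpt => w _; rewrite /lookup /D21_tab; map_tac. Qed.

Lemma pt_D21_sq (y : Sp R perms2) : cw y [:: 1; 0]%N * cw y [:: 1; 0]%N = 0.
Proof. by rewrite (cw_mul (L := [:: [:: 0; 1]; [:: 1; 0]; [:: 1]; [:: 0]]%N)). Qed.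


Definition pt_D21_e (y : Sp R perms2) : D := elem _ (pt_D21_sq y).

Lemma pt_D21_eq (y : Sp R perms2) :
  D21_lhs (opair (opair (letter 0 y) (letter 1 y)) (pt_D21_e y)) = opair 0 0.
Proof.
rewrite /D21_lhs !(pr1_pair, pr2_pair) !incl_letter incl_elem.
by congr opair; rewrite (cw_mul (L := [:: [:: 0; 1]; [:: 1; 0]; [:: 1]; [:: 0]]%N)).
Qed.
Definition pt_D21 (y : Sp R perms2) : D21 := elem _ (pt_D21_eq y).

Lemma D21_ptK x : pt_D21 (D21_pt x) = x.
Proof.
apply: incl_inj; rewrite incl_elem -[RHS]pair_eta -[pr1 (incl x) in RHS]pair_eta.
by congr opair; [congr opair|]; apply: D_inj;
  rewrite ?letter_mkpt // incl_elem cw_mkpt.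
Qed.

Lemma map_pt_D21 : is_map pt_D21.
Proof.
apply: map_elem; apply: map_pair; first apply: map_pair.
- by apply: map_letter; apply: Defs.map_id.
- by apply: map_letter; apply: Defs.map_id.
by apply: map_elem; apply: (map_cw (x := id)); apply: Defs.map_id.
Qed.

Lemma pt_D21_supp01 (y : Sp R perms2) : supported [:: [:: 0; 1]%N] y ->
  pt_D21 y = D21_face (letter 0 y) (letter 1 y).
Proof.
move=> y_supp; apply: incl_inj; rewrite !incl_elem; congr opair; apply: D_inj.
by rewrite incl_elem incl_D0 y_supp.
Qed.

Lemma pt_D21_supp10 (y : Sp R perms2) : supported [:: [:: 1; 0]%N] y ->
  pt_D21 y = D21_graph (letter 0 y) (letter 1 y).
Proof.
move=> y_supp; apply: incl_inj; rewrite !incl_elem; congr opair; apply: D_inj.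
rewrite !incl_elem (cw_mul (L := [:: [:: 0; 1]; [:: 1; 0]; [:: 1]; [:: 0]]%N)) //=.
by rewrite (y_supp [:: 0; 1]%N) //; ring.
Qed.

Lemma D21_face_supp d1 d2 : supported [:: [:: 0; 1]%N] (D21_pt (D21_face d1 d2)).
Proof.
apply: (supported_tab (L := [:: [:: 0; 1]; [:: 1; 0]; [:: 1]; [:: 0]]%N)) => //.
by rewrite /D21_tab !(incl_elem, pr1_pair, pr2_pair).
Qed.

Lemma D21_graph_supp d1 d2 : supported [:: [:: 1; 0]%N] (D21_pt (D21_graph d1 d2)).
Proof.
apply: (supported_tab (L := [:: [:: 0; 1]; [:: 1; 0]; [:: 1]; [:: 0]]%N)) => //.
by rewrite /D21_tab !(incl_elem, pr1_pair, pr2_pair) /=; split_all => //; ring.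
Qed.

Section Gluing.
Hypothesis KL : kock_lawvere R.
Variable X : space U.
Hypothesis HX : microlinear R X.

(** [D2] is a retract of [Sp R words2], whose facets 0 and 1 are sent to the two axes. *)
Lemma eq_D2 (l l' : D2 ~> X) :
  (forall d, l (D2l d) = l' (D2l d)) -> (forall d, l (D2r d) = l' (D2r d)) -> l = l'.
Proof.
move=> El Er; pose h (l : D2 ~> X) : Sp R words2 ~> X := lam (fun y => l (pt_D2 y))
  (map_app (map_const _ l) map_pt_D2).
have hE m y : h m y = m (pt_D2 y) by rewrite app_lam.
suff E : h l = h l' by apply: app_ext => x; rewrite -(D2_ptK x) -!hE E.
apply: (eq_on_facets KL HX) => // w; rewrite !inE => /orP[] /eqP-> y y_supp;
  rewrite !hE.
  suff -> : pt_D2 y = D2l (letter 0 y) by [].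
  by apply: incl_inj; rewrite !incl_elem; congr opair; apply: letter_supp y_supp _.
suff -> : pt_D2 y = D2r (letter 1 y) by [].
by apply: incl_inj; rewrite !incl_elem; congr opair; apply: letter_supp y_supp _.
Qed.

(** The facets 01 and 10 correspond to the face and the graph. Identities between maps on [D21] are
    all proved through this lemma. *)
Lemma eq_D21 (k k' : D21 ~> X) :
  (forall d1 d2, k (D21_face d1 d2) = k' (D21_face d1 d2)) ->
  (forall d1 d2, k (D21_graph d1 d2) = k' (D21_graph d1 d2)) -> k = k'.
Proof.
move=> Ef Eg; pose h (l : D21 ~> X) : Sp R perms2 ~> X := lam (fun y => l (pt_D21 y))
  (map_app (map_const _ l) map_pt_D21).
have hE m y : h m y = m (pt_D21 y) by rewrite app_lam.
suff E : h k = h k' by apply: app_ext => x; rewrite -(D21_ptK x) -!hE E.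
apply: (eq_on_facets KL HX) => // w; rewrite !inE => /orP[] /eqP-> y y_supp;
  rewrite !hE.
  by rewrite pt_D21_supp01.
by rewrite pt_D21_supp10.
Qed.

Lemma D21_glue (g1 g2 : times D D ~> X) :
  (forall x : D2, g1 (incl x) = g2 (incl x)) ->
  exists k : D21 ~> X, forall d1 d2,
    k (D21_face d1 d2) = g2 (opair d1 d2) /\ k (D21_graph d1 d2) = g1 (opair d1 d2).
Proof.
move=> g12.
pose t w := if w == [:: 0; 1]%N then g2 else g1.
have map_ll : @is_map U (Sp R perms2) (times D D)
    (fun y => opair (letter 0 y) (letter 1 y)).
  by apply: map_pair; apply: map_letter; apply: Defs.map_id.
pose g w : Sp R perms2 ~> X := lam _ (map_app (map_const _ (t w)) map_ll).
have gE w y : g w y = t w (opair (letter 0 y) (letter 1 y)) by rewrite app_lam.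
have [//|v w|h [Hh _]] := glue_on KL HX (g := g).
  (* The product of the two letters is the sum of the coordinates 01 and 10. Where both vanish, the
     pair of letters lies in D(2), on which [g1] and [g2] agree. *)
  have Ey (y : Sp R perms2) :
      cw y [:: 0; 1]%N = 0 -> cw y [:: 1; 0]%N = 0 ->
      g1 (opair (letter 0 y) (letter 1 y)) = g2 (opair (letter 0 y) (letter 1 y)).
    move=> y01 y10; have E : incl (pr1 (opair (letter 0 y) (letter 1 y))) *
             incl (pr2 (opair (letter 0 y) (letter 1 y))) = 0.
      rewrite pr1_pair pr2_pair !incl_letter.
      rewrite (cw_mul (L := [:: [:: 0; 1]; [:: 1; 0]; [:: 1]; [:: 0]]%N)) //=.
      by rewrite y01 y10; ring.
    by have := g12 (elem _ E); rewrite !incl_elem.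
  rewrite !inE => /orP[] /eqP-> /orP[] /eqP-> y y_supp //; rewrite !gE /t /=;
  by rewrite Ey // y_supp.
exists (lam _ (map_app (map_const _ h) map_D21_pt)) => d1 d2; rewrite !app_lam.
rewrite (Hh [:: 0; 1]%N) ?gE //; last exact: D21_face_supp.
rewrite (Hh [:: 1; 0]%N) ?gE //; last exact: D21_graph_supp.
by split; [congr (g2 _)|congr (g1 _)]; congr opair; apply: D_inj;
  rewrite letter_mkpt //= !(incl_elem, pr1_pair, pr2_pair).
Qed.

End Gluing.
End Infinitesimals.

(** * Brackets of semiforms *)

#[local] Hint Unfold D21_axis join_coords scale : maps.

Section Brackets.
Variables (U : cc_universe) (R : line U) (M : space U).
Local Open Scope line_scope.
Add Ring line_ring_tac' : (line_ring R).

Local Notation D := (D R).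
Local Notation D2 := (D2 R).
Local Notation D21 := (D21 R).
Local Notation cube n := (power D n).
Local Notation dist n := (dist M (cube n)).
Local Notation zero n := (tup (fun=> D0 R) : cube n).

Lemma Dscale1 (d : D) : Dscale 1 d = d.
Proof. by apply: D_inj; rewrite incl_elem; ring. Qed.

Definition scale_coord n (i : 'I_n) (a : R) (x : cube n) : cube n :=
  tup (fun j => if j == i then Dscale a (coord x j) else coord x j).

Lemma scaleE n i a (g : cube n ~> M) x : scale i a g x = g (scale_coord i a x).
Proof. by rewrite app_lam. Qed.

Lemma dirac0E n (g : cube n ~> M) : dirac0 R M n g = g (zero n).
Proof. by rewrite app_lam. Qed.

Lemma form0 n (w : semiform R M n) g : w (D0 R) g = g (zero n).
Proof. by rewrite form_of0 dirac0E. Qed.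

Lemma form_scaleE n (w : semiform R M n) i a d g :
  w (Dscale a d) g = w d (scale i a g).
Proof. by rewrite -(form_of_scale w i) app_lam. Qed.

Lemma coord_join_l p q (x : cube p) (y : cube q) j :
  coord (join_coords x y) (lshift q j) = coord x j.
Proof. by rewrite coord_tup (unsplitK (inl j)). Qed.

Lemma coord_join_r p q (x : cube p) (y : cube q) j :
  coord (join_coords x y) (rshift p j) = coord y j.
Proof. by rewrite coord_tup (unsplitK (inr j)). Qed.

Lemma join_zero p q : join_coords (zero p) (zero q) = zero (p + q).
Proof.
apply: coord_inj => i; rewrite coord_tup -(splitK i).
by case: (split i) => j; rewrite ?coord_join_l ?coord_join_r coord_tup.
Qed.

Lemma scale_join_l p q j a (x : cube p) (y : cube q) :
  scale_coord (lshift q j) a (join_coords x y) =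
  join_coords (scale_coord j a x) y.
Proof.
apply: coord_inj => i; rewrite coord_tup -(splitK i).
case: (split i) => k /=; rewrite ?coord_join_l ?coord_join_r ?coord_tup.
  by rewrite (inj_eq (@lshift_inj _ _)).
by rewrite eq_rlshift.
Qed.

Lemma scale_join_r p q j a (x : cube p) (y : cube q) :
  scale_coord (rshift p j) a (join_coords x y) =
  join_coords x (scale_coord j a y).
Proof.
apply: coord_inj => i; rewrite coord_tup -(splitK i).
case: (split i) => k /=; rewrite ?coord_join_l ?coord_join_r ?coord_tup.
  by rewrite eq_lrshift.
by rewrite (inj_eq (@rshift_inj _ _)).
Qed.

Section Circ.
Variables (p q : nat) (w1 : D ~> dist p) (w2 : D ~> dist q).

Lemma circE d e h : circ w1 w2 (opair d e) h =
  w1 d (mlam (fun a : cube p => w2 e (mlam (fun b : cube q =>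
    h (join_coords a b))))).
Proof.
rewrite !app_lam pr1_pair pr2_pair; congr (w1 d _).
apply: eq_lam => a; congr (w2 e _).
by apply: eq_lam => b; rewrite app_lam pr1_pair pr2_pair.
Qed.

Lemma circ_tildeE d e h : circ_tilde w1 w2 (opair d e) h =
  w2 e (mlam (fun b : cube q => w1 d (mlam (fun a : cube p =>
    h (join_coords a b))))).
Proof.
rewrite !app_lam pr1_pair pr2_pair; congr (w2 e _).
apply: eq_lam => b; congr (w1 d _).
by apply: eq_lam => a; rewrite app_lam pr1_pair pr2_pair.
Qed.

End Circ.

Lemma Dscale_mul a b (d e : D) : incl d * incl e = 0 ->
  incl (Dscale a d) * incl (Dscale b e) = 0.
Proof.
move=> de; rewrite !incl_elem.
by transitivity (a * b * (incl d * incl e)); [|rewrite de]; ring.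
Qed.

Lemma D21_scale_eq (a b : R) (x : D21) :
  D21_lhs (opair
    (opair (Dscale a (pr1 (pr1 (incl x)))) (Dscale b (pr2 (pr1 (incl x)))))
    (Dscale (a * b) (pr2 (incl x)))) = opair 0 0.
Proof.
have [E1 E2] := D21_mul x; rewrite /D21_lhs !(pr1_pair, pr2_pair).
by congr opair; apply: Dscale_mul.
Qed.

(** The third coordinate has the weight of d1 d2, which makes the action preserve the graph. *)
Definition D21_scale (a b : R) (x : D21) : D21 := elem _ (D21_scale_eq a b x).

Hint Unfold D21_scale : maps.

Lemma D21_scale_face a b d e :
  D21_scale a b (D21_face d e) = D21_face (Dscale a d) (Dscale b e).
Proof.
apply: incl_inj; rewrite !incl_elem !(pr1_pair, pr2_pair); congr opair.
by apply: D_inj; rewrite !incl_elem; ring.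
Qed.

Lemma D21_scale_graph a b d e :
  D21_scale a b (D21_graph d e) = D21_graph (Dscale a d) (Dscale b e).
Proof.
apply: incl_inj; rewrite !incl_elem !(pr1_pair, pr2_pair); congr opair.
by apply: D_inj; rewrite !incl_elem; ring.
Qed.

Lemma D21_scale_axis a b e :
  D21_scale a b (D21_axis e) = D21_axis (Dscale (a * b) e).
Proof.
apply: incl_inj; rewrite !incl_elem !(pr1_pair, pr2_pair).
by congr (opair (opair _ _) _); apply: D_inj; rewrite !incl_elem; ring.
Qed.

Lemma D21_axis0 : D21_axis (D0 R) = D21_face (D0 R) (D0 R).
Proof. by apply: incl_inj; rewrite !incl_elem. Qed.

Lemma map_D21_scale a b : is_map (D21_scale a b).
Proof. by rewrite /D21_scale; map_tac. Qed.

Hypotheses (KL : kock_lawvere R) (HM : microlinear R M).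

Lemma microlinear_dist n : microlinear R (dist n).
Proof. exact: microlinear_expo. Qed.

Section Bracket.
Variables (p q : nat) (w1 : semiform R M p) (w2 : semiform R M q).

(** The whole map [k] is retained, because iterated brackets use its values off the axis too. *)
Definition bracket_ext (b : semiform R M (p + q)) (k : D21 ~> dist (p + q)) :=
  [/\ forall d e, k (D21_face d e) = circ w1 w2 (opair d e),
      forall d e, k (D21_graph d e) = circ_tilde w1 w2 (opair d e) &
      forall e, b e = k (D21_axis e)].

(** On each axis of D(2) one form is a Dirac distribution, which commutes with any other under
    convolution. *)
Lemma circ_tilde_agree (x : D2) : circ_tilde w1 w2 (incl x) = circ w1 w2 (incl x).
Proof.
pose f (c : times D D ~> dist (p + q)) : D2 ~> dist (p + q) :=
  mlam (fun x : D2 => c (incl x)).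
have fE c y : f c y = c (incl y) by rewrite app_lam.
rewrite -!fE; congr (app _ x).
apply: (eq_D2 KL (@microlinear_dist _)) => d;
  rewrite !fE !incl_elem; apply: app_ext => h.
  rewrite circE circ_tildeE form0 app_lam; congr (w1 d _); apply: eq_lam => a.
  by rewrite form0 app_lam.
rewrite circE circ_tildeE form0 app_lam; congr (w2 d _); apply: eq_lam => a.
by rewrite form0 app_lam.
Qed.

Lemma circ_scale_l j a d e : dist_scale (lshift q j) a (circ w1 w2 (opair d e)) =
  circ w1 w2 (opair (Dscale a d) e).
Proof.
apply: app_ext => h; rewrite app_lam !circE (form_scaleE w1 j).
congr (w1 d _); apply: app_ext => x; rewrite scaleE !app_lam; congr (w2 e _).
by apply: eq_lam => y; rewrite scaleE scale_join_l.
Qed.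

Lemma circ_scale_r j a d e : dist_scale (rshift p j) a (circ w1 w2 (opair d e)) =
  circ w1 w2 (opair d (Dscale a e)).
Proof.
apply: app_ext => h; rewrite app_lam !circE.
congr (w1 d _); apply: eq_lam => x; rewrite (form_scaleE w2 j); congr (w2 e _).
by apply: app_ext => y; rewrite scaleE !app_lam -scale_join_r.
Qed.

Lemma circ_tilde_scale_l j a d e :
  dist_scale (lshift q j) a (circ_tilde w1 w2 (opair d e)) =
  circ_tilde w1 w2 (opair (Dscale a d) e).
Proof.
apply: app_ext => h; rewrite app_lam !circ_tildeE.
congr (w2 e _); apply: eq_lam => x; rewrite (form_scaleE w1 j); congr (w1 d _).
by apply: app_ext => y; rewrite scaleE !app_lam -scale_join_l.
Qed.

Lemma circ_tilde_scale_r j a d e :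
  dist_scale (rshift p j) a (circ_tilde w1 w2 (opair d e)) =
  circ_tilde w1 w2 (opair d (Dscale a e)).
Proof.
apply: app_ext => h; rewrite app_lam !circ_tildeE (form_scaleE w2 j).
congr (w2 e _); apply: app_ext => x; rewrite scaleE !app_lam; congr (w1 d _).
by apply: eq_lam => y; rewrite scaleE scale_join_r.
Qed.

Lemma bracket_exists : exists b k, is_bracket w1 w2 b /\ bracket_ext b k.
Proof.
have [k Hk] := D21_glue KL (@microlinear_dist _) circ_tilde_agree.
have kf d e : k (D21_face d e) = circ w1 w2 (opair d e) by case: (Hk d e).
have kg d e : k (D21_graph d e) = circ_tilde w1 w2 (opair d e) by case: (Hk d e).
pose f : D ~> dist (p + q) := mlam (fun e : D => k (D21_axis e)).
have fE e : f e = k (D21_axis e) by rewrite app_lam.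
have f0 : f (D0 R) = dirac0 R M (p + q).
  rewrite fE D21_axis0 kf; apply: app_ext => h.
  by rewrite circE dirac0E form0 app_lam form0 app_lam join_zero.
(* The argument [i] belongs to [w1] or to [w2], so scaling it scales d1 or d2: (b, c) is (a, 1) or
   (1, a). On the axis only the product b c matters. *)
have k_scale i a : exists b c, b * c = a /\
    forall x, dist_scale i a (k x) = k (D21_scale b c x).
  pose L : D21 ~> dist (p + q) := lam (fun x => dist_scale i a (k x))
    ltac:(rewrite /dist_scale; map_tac).
  have LE x : L x = dist_scale i a (k x) by rewrite app_lam.
  pose L' b c : D21 ~> dist (p + q) := lam (fun x => k (D21_scale b c x))
    (map_app (map_const _ k) (map_D21_scale b c)).
  have L'E b c x : L' b c x = k (D21_scale b c x) by rewrite app_lam.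
  rewrite -(splitK i) in L LE *; case: (split i) => j in L LE *.
    exists a, 1; split=> [|x]; first by ring.
    rewrite -LE -L'E; congr (app _ x).
    apply: (eq_D21 KL (@microlinear_dist _)) => d e; rewrite LE L'E.
      by rewrite D21_scale_face !kf circ_scale_l Dscale1.
    by rewrite D21_scale_graph !kg circ_tilde_scale_l Dscale1.
  exists 1, a; split=> [|x]; first by ring.
  rewrite -LE -L'E; congr (app _ x).
  apply: (eq_D21 KL (@microlinear_dist _)) => d e; rewrite LE L'E.
    by rewrite D21_scale_face !kf circ_scale_r Dscale1.
  by rewrite D21_scale_graph !kg circ_tilde_scale_r Dscale1.
have f_scale i a d : dist_scale i a (f d) = f (Dscale a d).
  have [b [c [<- Hbc]]] := k_scale i a.
  by rewrite !fE Hbc D21_scale_axis.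
exists (Semiform f0 f_scale), k; split; last by split.
split; first exact: circ_tilde_agree.
exists k; split=> //; split=> [d e|k' Hk']; first by rewrite kf kg.
apply: (eq_D21 KL (@microlinear_dist _)) => d e.
  by rewrite kf; case: (Hk' d e).
by rewrite kg; case: (Hk' d e).
Qed.

End Bracket.

Lemma tangent_sum_of n (l : D2 ~> dist n) (t1 t2 t : D ~> dist n) :
  (forall d, l (D2l d) = t1 d) -> (forall d, l (D2r d) = t2 d) ->
  (forall d, t d = l (D2diag d)) -> is_tangent_sum t1 t2 t.
Proof.
move=> H1 H2 H; exists l; split=> //; split=> // l' [H1' H2'].
by apply: (eq_D2 KL (@microlinear_dist _)) => d; rewrite ?H1 ?H2 ?H1' ?H2'.
Qed.

End Brackets.

Arguments microlinear_dist {U R M} HM n.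

(** * Points of the shuffle algebra on three letters *)

Definition perms3 : seq word :=
  [:: [:: 0; 1; 2]; [:: 0; 2; 1]; [:: 1; 0; 2];
      [:: 1; 2; 0]; [:: 2; 0; 1]; [:: 2; 1; 0]]%N.

Definition words3 : seq word := Eval vm_compute in lang perms3.

Lemma lang_perms3 : lang perms3 = words3. Proof. by vm_compute. Qed.

(** The three iterated brackets differ by a rotation of the letters, and are treated together. *)
Definition cyclic3 (a b c : nat) : bool :=
  [|| [&& a == 0, b == 1 & c == 2], [&& a == 1, b == 2 & c == 0]
    | [&& a == 2, b == 0 & c == 1]]%N.

Lemma cyclic3_ind (P : nat -> nat -> nat -> Prop) :
  P 0 1 2 -> P 1 2 0 -> P 2 0 1 -> forall a b c, cyclic3 a b c -> P a b c.
Proof. by move=> P0 P1 P2 a b c /or3P[] /and3P[/eqP-> /eqP-> /eqP->]. Qed.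

Ltac tab_tac := cbv -[ladd lmul lopp l0 l1 line_space pt]; split_all.

Section TablePoints.
Variables (U : cc_universe) (R : line U).
Local Open Scope line_scope.
Add Ring line_ring_tac' : (line_ring R).
Local Notation "x - y" := (x + lopp 1 * y) : line_scope.
Local Notation "- x" := (lopp 1 * x) : line_scope.
Local Notation D := (D R).
Local Notation D2 := (D2 R).
Local Notation D21 := (D21 R).

(* The coefficients of the group-like noncommutative polynomials              *)
(*   (1 + x a) (1 + y b) (1 + z c) (1 + e [c, b])         for psi,            *)
(*   (1 + y b) (1 + z c) (1 + e [c, b]) (1 + x a)         for psi',           *)
(*   (1 + x a) (1 + y [c, b]) (1 + e [a, [b, c]])         for chi,            *)
(*   1 + x [0, [1, 2]] + y [1, [2, 0]]                    for phi.            *)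
Definition psi_tab (a b c : nat) (x y z e : R) :=
  [:: ([:: a], x); ([:: b], y); ([:: c], z);
      ([:: a; b], x * y); ([:: a; c], x * z); ([:: b; c], y * z - e);
      ([:: c; b], e); ([:: a; b; c], x * (y * z - e)); ([:: a; c; b], x * e)].

Definition psi'_tab (a b c : nat) (x y z e : R) :=
  [:: ([:: a], x); ([:: b], y); ([:: c], z);
      ([:: b; a], x * y); ([:: c; a], x * z); ([:: b; c], y * z - e);
      ([:: c; b], e); ([:: b; c; a], x * (y * z - e)); ([:: c; b; a], x * e)].

Definition chi_tab (a b c : nat) (x y e : R) :=
  [:: ([:: a], x); ([:: b; c], - y); ([:: c; b], y);
      ([:: a; b; c], e - x * y); ([:: a; c; b], x * y - e);
      ([:: b; c; a], - e); ([:: c; b; a], e)].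

Definition phi_tab (x y : R) :=
  [:: ([:: 0; 1; 2]%N, x); ([:: 2; 1; 0]%N, x); ([:: 0; 2; 1]%N, y - x);
      ([:: 1; 2; 0]%N, y - x); ([:: 1; 0; 2]%N, - y); ([:: 2; 0; 1]%N, - y)].

Lemma psi_char a b c (x y z e : R) : cyclic3 a b c ->
  x * x = 0 -> y * y = 0 -> z * z = 0 -> e * e = 0 -> y * e = 0 -> z * e = 0 ->
  is_char perms3 (lookup (psi_tab a b c x y z e)).
Proof.
move=> abc Hx Hy Hz He Hye Hze; move: a b c abc; apply: cyclic3_ind.
all: by char_tac perms3; ring [Hx Hy Hz He Hye Hze].
Qed.

Lemma psi'_char a b c (x y z e : R) : cyclic3 a b c ->
  x * x = 0 -> y * y = 0 -> z * z = 0 -> e * e = 0 -> y * e = 0 -> z * e = 0 ->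
  is_char perms3 (lookup (psi'_tab a b c x y z e)).
Proof.
move=> abc Hx Hy Hz He Hye Hze; move: a b c abc; apply: cyclic3_ind.
all: by char_tac perms3; ring [Hx Hy Hz He Hye Hze].
Qed.

Lemma chi_char a b c (x y e : R) : cyclic3 a b c ->
  x * x = 0 -> y * y = 0 -> e * e = 0 -> x * e = 0 -> y * e = 0 ->
  is_char perms3 (lookup (chi_tab a b c x y e)).
Proof.
move=> abc Hx Hy He Hxe Hye; move: a b c abc; apply: cyclic3_ind.
all: by char_tac perms3; ring [Hx Hy He Hxe Hye].
Qed.

Lemma phi_char (x y : R) : x * x = 0 -> y * y = 0 -> x * y = 0 ->
  is_char perms3 (lookup (phi_tab x y)).
Proof. by move=> Hx Hy Hxy; char_tac perms3; ring [Hx Hy Hxy]. Qed.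

Lemma mkpt_eq_tab (f g : word -> R) (Hf : is_char perms3 f) (Hg : is_char perms3 g) :
  all_prop (fun w => f w = g w) words3 -> mkpt Hf = mkpt Hg.
Proof.
rewrite -lang_perms3 => /all_propP H.
by apply: cw_inj => w wF; rewrite !cw_mkpt // H.
Qed.

Local Notation c1 y := (incl (pr1 (pr1 (incl y)))).
Local Notation c2 y := (incl (pr2 (pr1 (incl y)))).
Local Notation c3 y := (incl (pr2 (incl y))).

Section Cyclic.
Variables (a b c : nat) (abc : cyclic3 a b c).

Definition psi (x : D) (y : D21) : Sp R perms3 :=
  mkpt (psi_char abc (D_eq x) (D_eq (pr1 (pr1 (incl y))))
    (D_eq (pr2 (pr1 (incl y)))) (D_eq (pr2 (incl y))) (D21_mul y).1 (D21_mul y).2).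

Definition psi' (x : D) (y : D21) : Sp R perms3 :=
  mkpt (psi'_char abc (D_eq x) (D_eq (pr1 (pr1 (incl y))))
    (D_eq (pr2 (pr1 (incl y)))) (D_eq (pr2 (incl y))) (D21_mul y).1 (D21_mul y).2).

Definition chi (y : D21) : Sp R perms3 :=
  mkpt (chi_char abc (D_eq (pr1 (pr1 (incl y)))) (D_eq (pr2 (pr1 (incl y))))
    (D_eq (pr2 (incl y))) (D21_mul y).1 (D21_mul y).2).

Lemma map_psi x : is_map (psi x).
Proof. by apply: map_mkpt => w _; rewrite /lookup /psi_tab; map_tac. Qed.

Lemma map_psi' x : is_map (psi' x).
Proof. by apply: map_mkpt => w _; rewrite /lookup /psi'_tab; map_tac. Qed.

Lemma map_chi : is_map chi.
Proof. by apply: map_mkpt => w _; rewrite /lookup /chi_tab; map_tac. Qed.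

Lemma cyclic3_in : [/\ [:: a] \in lang perms3, [:: b] \in lang perms3 &
  [:: c] \in lang perms3].
Proof. by rewrite lang_perms3; move: a b c abc; apply: cyclic3_ind. Qed.

Lemma cyclic3_perms : [/\ [:: a; b; c] \in perms3, [:: a; c; b] \in perms3,
  [:: b; c; a] \in perms3 & [:: c; b; a] \in perms3].
Proof. by move: a b c abc; apply: cyclic3_ind. Qed.

Lemma cyclic3_neq : [/\ (a == b) = false, (a == c) = false, (b == c) = false &
  [&& (a < 3), (b < 3) & (c < 3)]]%N.
Proof. by move: a b c abc; apply: cyclic3_ind. Qed.

Lemma psi_letters x y : [/\ letter a (psi x y) = x,
  letter b (psi x y) = pr1 (pr1 (incl y)) &
  letter c (psi x y) = pr2 (pr1 (incl y))].
Proof.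
have [ain bin cin] := cyclic3_in; have [ab ac bc _] := cyclic3_neq.
split; apply: D_inj; rewrite letter_mkpt //= !eqseq_cons !andbT ?eqxx //.
  by rewrite eq_sym ab.
by rewrite eq_sym ac eq_sym bc.
Qed.

Lemma psi'_letters x y : [/\ letter a (psi' x y) = x,
  letter b (psi' x y) = pr1 (pr1 (incl y)) &
  letter c (psi' x y) = pr2 (pr1 (incl y))].
Proof.
have [ain bin cin] := cyclic3_in; have [ab ac bc _] := cyclic3_neq.
split; apply: D_inj; rewrite letter_mkpt //= !eqseq_cons !andbT ?eqxx //.
  by rewrite eq_sym ab.
by rewrite eq_sym ac eq_sym bc.
Qed.

Lemma psi_face_supp x d e : supported [:: [:: a; b; c]] (psi x (D21_face d e)).
Proof.
apply: (supported_tab _ lang_perms3); rewrite !(incl_elem, pr1_pair, pr2_pair).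
move: (incl x) (incl d) (incl e) => {}x {}d {}e.
by move: a b c abc; apply: cyclic3_ind; tab_tac; ring.
Qed.

Lemma psi_graph_supp x d e : supported [:: [:: a; c; b]] (psi x (D21_graph d e)).
Proof.
apply: (supported_tab _ lang_perms3); rewrite !(incl_elem, pr1_pair, pr2_pair).
move: (incl x) (incl d) (incl e) => {}x {}d {}e.
by move: a b c abc; apply: cyclic3_ind; tab_tac; ring.
Qed.

Lemma psi'_face_supp x d e : supported [:: [:: b; c; a]] (psi' x (D21_face d e)).
Proof.
apply: (supported_tab _ lang_perms3); rewrite !(incl_elem, pr1_pair, pr2_pair).
move: (incl x) (incl d) (incl e) => {}x {}d {}e.
by move: a b c abc; apply: cyclic3_ind; tab_tac; ring.
Qed.

Lemma psi'_graph_supp x d e : supported [:: [:: c; b; a]] (psi' x (D21_graph d e)).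
Proof.
apply: (supported_tab _ lang_perms3); rewrite !(incl_elem, pr1_pair, pr2_pair).
move: (incl x) (incl d) (incl e) => {}x {}d {}e.
by move: a b c abc; apply: cyclic3_ind; tab_tac; ring.
Qed.

Lemma chi_face d e : chi (D21_face d e) = psi d (D21_axis e).
Proof.
apply: mkpt_eq_tab; rewrite !(incl_elem, pr1_pair, pr2_pair).
move: (incl d) (incl e) => {}d {}e.
by move: a b c abc; apply: cyclic3_ind; tab_tac; ring.
Qed.

(** With B = [c, b] one has [a, [b, c]] = [B, a], and (1 + x a)(1 + y B)(1 + x y [B, a]) = (1 + y
    B)(1 + x a): the last factor swaps the other two. *)
Lemma chi_graph d e : chi (D21_graph d e) = psi' d (D21_axis e).
Proof.
apply: mkpt_eq_tab; rewrite !(incl_elem, pr1_pair, pr2_pair).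
move: (incl d) (incl e) => {}d {}e.
by move: a b c abc; apply: cyclic3_ind; tab_tac; ring.
Qed.

End Cyclic.

Definition phi (y : D2) : Sp R perms3 :=
  mkpt (phi_char (D_eq (pr1 (incl y))) (D_eq (pr2 (incl y))) (D2_mul y)).

Lemma map_phi : is_map phi.
Proof. by apply: map_mkpt => w _; rewrite /lookup /phi_tab; map_tac. Qed.

Lemma phi_l (abc : cyclic3 0 1 2) d : phi (D2l d) = chi abc (D21_axis d).
Proof.
apply: mkpt_eq_tab; rewrite !(incl_elem, pr1_pair, pr2_pair).
by move: (incl d) => {}d; tab_tac; ring.
Qed.

Lemma phi_r (abc : cyclic3 1 2 0) d : phi (D2r d) = chi abc (D21_axis d).
Proof.
apply: mkpt_eq_tab; rewrite !(incl_elem, pr1_pair, pr2_pair).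
by move: (incl d) => {}d; tab_tac; ring.
Qed.

(** This is the Jacobi identity of the free Lie algebra, [0, [1, 2]] + [1, [2, 0]] = - [2,
    [0, 1]]. *)
Lemma phi_diag (abc : cyclic3 2 0 1) d :
  phi (D2diag d) = chi abc (D21_axis (Dscale (lopp 1) d)).
Proof.
apply: mkpt_eq_tab; rewrite !(incl_elem, pr1_pair, pr2_pair).
by move: (incl d) => {}d; tab_tac; ring.
Qed.

End TablePoints.

(** * Convolutions of three semiforms *)

Section Core.
Variables (U : cc_universe) (R : line U) (M : space U).
Hypotheses (KL : kock_lawvere R) (HM : microlinear R M).
Variables (p q r : nat).
Variables (w1 : semiform R M p) (w2 : semiform R M q) (w3 : semiform R M r).

Local Notation D := (D R).
Local Notation D2 := (D2 R).
Local Notation D21 := (D21 R).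
Local Notation cube n := (power D n).
Local Notation dist n := (dist M (cube n)).
Local Notation zero n := (tup (fun=> D0 R) : cube n).
Local Notation X := (dist (p + q + r)).

Definition recoord m n (f : 'I_n -> 'I_m) (x : cube m) : cube n :=
  tup (fun i => coord x (f i)).

Hint Unfold recoord : maps.

Definition push m n (f : 'I_n -> 'I_m) (phi : dist m) : dist n :=
  mlam (fun h : cube n ~> M => phi (mlam (fun x : cube m => h (recoord f x)))).

Hint Unfold push : maps.

Definition dim (a : nat) : nat := match a with 0 => p | 1 => q | _ => r end.

Definition frm (a : nat) : semiform R M (dim a) :=
  match a with 0 => w1 | 1 => w2 | _ => w3 end.

(** The three blocks of arguments keep fixed places, so that convolutions in any order act on the
    same functions. *)
Definition env : space U := times (cube p) (times (cube q) (cube r)).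

Definition set_env (a : nat) : cube (dim a) ~> env ~> env :=
  match a return cube (dim a) ~> env ~> env with
  | 0 => mlam (fun x : cube p => mlam (fun v : env => opair x (pr2 v)))
  | 1 => mlam (fun x : cube q => mlam (fun v : env =>
      opair (pr1 v) (opair x (pr2 (pr2 v)))))
  | _ => mlam (fun x : cube r => mlam (fun v : env =>
      opair (pr1 v) (opair (pr1 (pr2 v)) x)))
  end.

Definition env0 : env := opair (zero p) (opair (zero q) (zero r)).

Lemma set_env0 a : set_env a (zero (dim a)) env0 = env0.
Proof. by case: a => [|[|a]]; rewrite !app_lam !(pr1_pair, pr2_pair). Qed.

Lemma set_envC a b x y v : (a < 3)%N -> (b < 3)%N -> (a == b) = false ->
  set_env a x (set_env b y v) = set_env b y (set_env a x v).
Proof.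
by case: a x => [|[|[|a]]] x //; case: b y => [|[|[|b]]] y // _ _ _;
  rewrite !app_lam !(pr1_pair, pr2_pair).
Qed.

Definition assemble (v : env) : cube (p + q + r) :=
  join_coords (join_coords (pr1 v) (pr1 (pr2 v))) (pr2 (pr2 v)).

Hint Unfold assemble : maps.

(* Convolution with the a-th form, on functions of all the arguments. *)
Definition act (a : nat) : D ~> (env ~> M) ~> env ~> M :=
  mlam (fun d : D => mlam (fun H : env ~> M => mlam (fun v : env =>
    frm a d (mlam (fun x : cube (dim a) => H (set_env a x v)))))).

Lemma actE a d H v :
  act a d H v = frm a d (mlam (fun x : cube (dim a) => H (set_env a x v))).
Proof. by rewrite !app_lam. Qed.

Definition acts (s : word) (d : nat -> D) (H : env ~> M) : env ~> M :=
  foldr (fun a => act a (d a)) H s.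

Lemma map_acts (Z : space U) s (d : Z -> nat -> D) (H : Z -> env ~> M) :
  (forall a, is_map (fun z => d z a)) -> is_map H ->
  is_map (fun z => acts s (d z) (H z)).
Proof.
move=> Hd HH; elim: s => [|a s IH] //=.
by apply: map_app IH; apply: map_app (Hd a); apply: map_const.
Qed.

(** A form with parameter 0 evaluates its block at zero. If that block of [v] is zero already,
    nothing changes and the letter can be erased. *)
Lemma acts_subseq s u d H v : subseq u s -> uniq s ->
  (forall a, a \in s -> (a < 3)%N) ->
  (forall a, a \in s -> a \notin u -> d a = D0 R /\ set_env a (zero _) v = v) ->
  acts s d H v = acts u d H v.
Proof.
elim: s u v => [|a s IH] u v; first by rewrite subseq0 => /eqP->.
move=> us /= /andP[a_s s_uniq] lt3 Hd.
have lt3' b : b \in s -> (b < 3)%N by move=> bs; apply: lt3; rewrite inE bs orbT.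
have drop : subseq u s -> act a (d a) (acts s d H) v = acts u d H v.
  move=> us'; have au : a \notin u by apply: contra a_s; apply: mem_subseq.
  have [-> Ev] := Hd a (mem_head _ _) au.
  rewrite actE form0 app_lam Ev; apply: IH => // b bs bu.
  by apply: Hd; rewrite // inE bs orbT.
case: u us Hd drop => [|b u] us Hd drop; first by apply: drop; apply: sub0seq.
move: us => /=; case: (b =P a) Hd drop => [-> | _] Hd drop us; last exact: drop.
rewrite !actE; congr (frm a (d a) _); apply: eq_lam => x.
apply: IH => // c cs cu.
have ca : c != a by apply: contraNneq a_s => <-.
have [|| -> Ec] := Hd c; first by rewrite inE cs orbT.
  by rewrite inE negb_or ca.
split=> //; rewrite set_envC; first by rewrite Ec.
- exact: lt3'.
- by apply: lt3; rewrite mem_head.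
exact: negPf.
Qed.

Definition pull (h : cube (p + q + r) ~> M) : env ~> M :=
  mlam (fun v : env => h (assemble v)).

Hint Unfold pull : maps.

Lemma map_run2 F s : @is_map U (times (Sp R F) (cube (p + q + r) ~> M)) M
  (fun z => acts s (fun a => letter a (pr1 z)) (pull (pr2 z)) env0).
Proof.
apply: map_app; last exact: map_const; apply: map_acts => [a|].
  by apply: map_letter; apply: map_pr1.
by rewrite /pull; map_tac.
Qed.

Lemma map_run1 F s (y : Sp R F) :
  is_map (fun h => acts s (fun a => letter a y) (pull h) env0).
Proof.
apply: map_app; last exact: map_const.
by apply: map_acts => [a|]; rewrite /pull; map_tac.
Qed.

Definition run F (s : word) : Sp R F ~> X :=
  lam (fun y => lam _ (map_run1 s y)) (map_curry _ (map_run2 F s)).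

Lemma runE F s (y : Sp R F) h :
  run F s y h = acts s (fun a => letter a y) (pull h) env0.
Proof. by rewrite !app_lam. Qed.

Lemma run3E F a b c (y : Sp R F) h : run F [:: a; b; c] y h =
  frm a (letter a y) (mlam (fun x : cube (dim a) =>
    frm b (letter b y) (mlam (fun x' : cube (dim b) =>
      frm c (letter c y) (mlam (fun x'' : cube (dim c) =>
        h (assemble (set_env c x'' (set_env b x' (set_env a x env0)))))))))).
Proof.
rewrite runE /acts /= actE; congr (frm a _ _); apply: eq_lam => x.
rewrite actE; congr (frm b _ _); apply: eq_lam => x'.
rewrite actE; congr (frm c _ _); apply: eq_lam => x''.
by rewrite /pull app_lam.
Qed.

(** On each facet u of the overlap, a common subword of [s] and [t], both convolutions reduce to the
    one in the order u. *)
Lemma run_meet F s t (y : Sp R F) : s \in perms3 -> t \in perms3 ->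
  subl (meet s t) F -> supported (meet s t) y -> run F s y = run F t y.
Proof.
move=> sP tP st_sub y_supp.
have meet_neq0 : meet s t != [::].
  have : all (fun s => all (fun t => [:: 0%N] \in lang (meet s t)) perms3) perms3.
    by vm_compute.
  move=> /allP/(_ _ sP)/allP/(_ _ tP).
  by rewrite mem_lang; case: (meet s t).
have permP s' : s' \in perms3 -> uniq s' /\ forall a, a \in s' -> (a < 3)%N.
  have : all (fun s => uniq s && all (ltn^~ 3) s) perms3 by vm_compute.
  by move=> /allP H /H /andP[? /allP].
have [z <-] := supported_inc st_sub y_supp.
pose f s' : Sp R (meet s t) ~> X :=
  mlam (fun z : Sp R (meet s t) => run F s' (inc R _ F z)).
have fE s' x : f s' x = run F s' (inc R _ F x) by rewrite {1}/f app_lam.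
rewrite -!fE; congr (app _ z).
apply: (eq_on_facets KL (microlinear_dist HM _)) => // u u_st {y_supp}z z_supp.
apply: app_ext => h; rewrite !fE !runE.
have acts_u s' : s' \in perms3 -> subseq u s' ->
    acts s' (fun a => letter a (inc R (meet s t) F z)) (pull h) env0 =
    acts u (fun a => letter a (inc R (meet s t) F z)) (pull h) env0.
  move=> /permP[s'_uniq s'_lt3] us'; apply: acts_subseq => // a _ au.
  split; last exact: set_env0.
  rewrite letter_inc //; apply: letter_supp z_supp _.
  by rewrite mem_lang /= sub1seq orbF.
move: u_st; rewrite mem_filter !mem_lang /= !orbF.
move=> /andP[/and3P[_ _ ut] /and3P[_ _ us]].
by rewrite !acts_u.
Qed.

Lemma run_glue : exists l : Sp R perms3 ~> X, forall s, s \in perms3 ->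
  forall y : Sp R perms3, supported [:: s] y -> l y = run perms3 s y.
Proof.
have [//|s t sP tP y|l [Hl _]] :=
  glue_on KL (microlinear_dist HM _) (g := run perms3) (F := perms3).
  apply: run_meet => //; apply: subl_trans (subl_meetl _ _) _.
  by apply: subl_facets => w; rewrite inE => /eqP->.
by exists l.
Qed.

Section Bracket3.
Variable l : Sp R perms3 ~> X.
Hypothesis l_run : forall s, s \in perms3 ->
  forall y : Sp R perms3, supported [:: s] y -> l y = run perms3 s y.
Variables (a b c : nat) (abc : cyclic3 a b c).
Variables (wbc : semiform R M (dim b + dim c)) (k : D21 ~> dist (dim b + dim c)).
Hypothesis Hk : bracket_ext (frm b) (frm c) wbc k.
Variables (j : semiform R M (dim a + (dim b + dim c))).
Variable kj : D21 ~> dist (dim a + (dim b + dim c)).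
Hypothesis Hkj : bracket_ext (frm a) wbc j kj.
(** Stands for each of the three rearrangements that bring the blocks a, b, c back to the order of
    the forms. *)
Variable f : 'I_(p + q + r) -> 'I_(dim a + (dim b + dim c)).
Hypothesis f_assemble : forall x x' x'',
  recoord f (join_coords x (join_coords x' x'')) =
  assemble (set_env a x (set_env b x' (set_env c x'' env0))).

Let lt3 : [&& (a < 3), (b < 3) & (c < 3)]%N.
Proof. by case: (cyclic3_neq abc). Qed.

(** For fixed [x] both sides are maps of [y]. On the face and on the graph, [psi] lies in the facets
    abc and acb, where [l] is a known convolution. *)
Lemma l_psi x y h : l (psi abc x y) h =
  frm a x (mlam (fun u : cube (dim a) => k y (mlam (fun v : cube (dim b + dim c) =>
    h (recoord f (join_coords u v)))))).
Proof.
have [k_face k_graph _] := Hk; have [abcP acbP _ _] := cyclic3_perms abc.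
have [ab ac bc _] := cyclic3_neq abc; have /and3P[a3 b3 c3] := lt3.
pose K : D21 ~> X := mlam (fun y : D21 => mlam (fun h : cube (p + q + r) ~> M =>
  frm a x (mlam (fun u : cube (dim a) => k y (mlam (fun v : cube (dim b + dim c) =>
    h (recoord f (join_coords u v)))))))).
have KE z g : K z g = frm a x (mlam (fun u : cube (dim a) =>
    k z (mlam (fun v : cube (dim b + dim c) => g (recoord f (join_coords u v)))))).
  by rewrite {1}/K !app_lam.
pose L : D21 ~> X := lam _ (map_app (map_const _ l) (map_psi abc x)).
have LE z : L z = l (psi abc x z) by rewrite app_lam.
rewrite -KE -LE; congr (app (app _ y) h).
apply: (eq_D21 KL (microlinear_dist HM _)) => d e;
  apply: app_ext => g; rewrite KE LE.
  rewrite (l_run abcP (psi_face_supp abc x d e)) run3E.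
  have [-> -> ->] := psi_letters abc x (D21_face d e).
  rewrite !(incl_elem, pr1_pair, pr2_pair); congr (frm a x _); apply: eq_lam => u.
  rewrite k_face circE; congr (frm b d _); apply: eq_lam => v.
  congr (frm c e _); apply: eq_lam => w; rewrite app_lam f_assemble.
  rewrite (set_envC _ _ _ b3 c3 bc) (set_envC _ _ _ a3 c3 ac).
  by rewrite (set_envC _ _ _ a3 b3 ab).
rewrite (l_run acbP (psi_graph_supp abc x d e)) run3E.
have [-> -> ->] := psi_letters abc x (D21_graph d e).
rewrite !(incl_elem, pr1_pair, pr2_pair); congr (frm a x _); apply: eq_lam => u.
rewrite k_graph circ_tildeE; congr (frm c e _); apply: eq_lam => v.
congr (frm b d _); apply: eq_lam => w; rewrite app_lam f_assemble.
by rewrite (set_envC _ _ _ a3 b3 ab) (set_envC _ _ _ a3 c3 ac).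
Qed.

Lemma l_psi' x y h : l (psi' abc x y) h =
  k y (mlam (fun v : cube (dim b + dim c) => frm a x (mlam (fun u : cube (dim a) =>
    h (recoord f (join_coords u v)))))).
Proof.
have [k_face k_graph _] := Hk; have [_ _ bcaP cbaP] := cyclic3_perms abc.
have [ab ac bc _] := cyclic3_neq abc; have /and3P[a3 b3 c3] := lt3.
pose K : D21 ~> X := mlam (fun y : D21 => mlam (fun h : cube (p + q + r) ~> M =>
  k y (mlam (fun v : cube (dim b + dim c) => frm a x (mlam (fun u : cube (dim a) =>
    h (recoord f (join_coords u v)))))))).
have KE z g : K z g = k z (mlam (fun v : cube (dim b + dim c) =>
    frm a x (mlam (fun u : cube (dim a) => g (recoord f (join_coords u v)))))).
  by rewrite {1}/K !app_lam.
pose L : D21 ~> X := lam _ (map_app (map_const _ l) (map_psi' abc x)).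
have LE z : L z = l (psi' abc x z) by rewrite app_lam.
rewrite -KE -LE; congr (app (app _ y) h).
apply: (eq_D21 KL (microlinear_dist HM _)) => d e;
  apply: app_ext => g; rewrite KE LE.
  rewrite (l_run bcaP (psi'_face_supp abc x d e)) run3E.
  have [-> -> ->] := psi'_letters abc x (D21_face d e).
  rewrite !(incl_elem, pr1_pair, pr2_pair) k_face circE.
  congr (frm b d _); apply: eq_lam => u; congr (frm c e _); apply: eq_lam => v.
  rewrite app_lam; congr (frm a x _); apply: eq_lam => w; rewrite f_assemble.
  by rewrite (set_envC _ _ _ b3 c3 bc).
rewrite (l_run cbaP (psi'_graph_supp abc x d e)) run3E.
have [-> -> ->] := psi'_letters abc x (D21_graph d e).
rewrite !(incl_elem, pr1_pair, pr2_pair) k_graph circ_tildeE.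
congr (frm c e _); apply: eq_lam => u; congr (frm b d _); apply: eq_lam => v.
by rewrite app_lam; congr (frm a x _); apply: eq_lam => w; rewrite f_assemble.
Qed.

(** Again by [eq_D21], now in the parameters of the outer bracket: on the face and the graph [chi]
    becomes [psi] and [psi'], whose second parameter runs along the axis that defines the inner
    bracket. *)
Lemma push_bracket3 e : push f (j e) = l (chi abc (D21_axis e)).
Proof.
have [k_face k_graph j_axis] := Hkj; have [_ _ w_axis] := Hk.
pose K : D21 ~> X := mlam (fun y : D21 => push f (kj y)).
have KE z : K z = push f (kj z) by rewrite app_lam.
pose L : D21 ~> X := lam _ (map_app (map_const _ l) (map_chi R abc)).
have LE z : L z = l (chi abc z) by rewrite app_lam.
rewrite j_axis -KE -LE; congr (app _ _).
apply: (eq_D21 KL (microlinear_dist HM _)) => x y; apply: app_ext => h.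
  rewrite KE LE chi_face l_psi app_lam k_face circE.
  congr (frm a x _); apply: eq_lam => u; rewrite w_axis; congr (k _ _).
  by apply: eq_lam => v; rewrite app_lam.
rewrite KE LE chi_graph l_psi' app_lam k_graph circ_tildeE w_axis.
congr (k _ _); apply: eq_lam => v; congr (frm a x _).
by apply: eq_lam => u; rewrite app_lam.
Qed.

End Bracket3.
End Core.

(** * Rearranging the arguments *)

#[local] Hint Unfold recoord push : maps.

Section Arguments.
Variables (U : cc_universe) (R : line U) (M : space U).
Local Open Scope line_scope.
Add Ring line_ring_tac' : (line_ring R).
Local Notation D := (D R).
Local Notation D2 := (D2 R).
Local Notation cube n := (power D n).
Local Notation dist n := (dist M (cube n)).

(** With numbers as indices and a default beyond the range, rearrangements of blocks become linear
    arithmetic. *)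
Definition coord_nat n (x : cube n) (k : nat) : D :=
  if insub k is Some i then coord x i else D0 R.

Lemma coord_natE n (x : cube n) (i : 'I_n) : coord x i = coord_nat x i.
Proof. by rewrite /coord_nat valK. Qed.

Lemma coord_nat_join p q (x : cube p) (y : cube q) k :
  coord_nat (join_coords x y) k =
  if (k < p)%N then coord_nat x k else coord_nat y (k - p).
Proof.
have [lt|ge] := ltnP k (p + q); last first.
  rewrite /coord_nat insubF; last by rewrite ltnNge ge.
  by rewrite ifF ?insubF //; lia.
rewrite -[k in LHS]/(val (Ordinal lt)) -coord_natE coord_tup.
case: splitP => i /= ->; first by rewrite ltn_ord coord_natE.
by rewrite ltnNge leq_addr addKn coord_natE.
Qed.

Lemma eq_coord_nat n (x y : cube n) :
  (forall i : 'I_n, coord_nat x i = coord_nat y i) -> x = y.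
Proof. by move=> E; apply: coord_inj => i; rewrite !coord_natE. Qed.

Lemma coord_nat_recoord m n (f : 'I_n -> 'I_m) (x : cube m) (i : 'I_n) :
  coord_nat (recoord f x) i = coord_nat x (f i).
Proof. by rewrite -!coord_natE coord_tup. Qed.

Lemma pushE m n (f : 'I_n -> 'I_m) (phi : dist m) h :
  push f phi h = phi (mlam (fun x : cube m => h (recoord f x))).
Proof. by rewrite app_lam. Qed.

Lemma push_push m n k (f : 'I_n -> 'I_m) (g : 'I_k -> 'I_n) (phi : dist m) :
  push g (push f phi) = push (f \o g) phi.
Proof.
apply: app_ext => h; rewrite !pushE; congr (phi _); apply: eq_lam => x.
rewrite app_lam; congr (h _); apply: coord_inj => i.
by rewrite !coord_tup.
Qed.

Lemma form_castE m n (e : m = n) (w : D ~> dist m) d :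
  form_cast e w d = push (cast_ord (esym e)) (w d).
Proof.
case: n / e; apply: app_ext => h; rewrite pushE; congr (w d _).
apply: app_ext => x; rewrite app_lam; congr (h _); apply: coord_inj => i.
by rewrite coord_tup cast_ord_id.
Qed.

Lemma form_permuteE n (s : {perm 'I_n}) (w : D ~> dist n) d :
  form_permute s w d = push s (w d).
Proof.
by apply: app_ext => h; rewrite !app_lam.
Qed.

Lemma dist_scale_push m n (f : 'I_n -> 'I_m) (phi : dist m) i a : injective f ->
  dist_scale i a (push f phi) = push f (dist_scale (f i) a phi).
Proof.
move=> f_inj; apply: app_ext => h; rewrite !app_lam; congr (phi _).
apply: app_ext => x; rewrite !app_lam; congr (h _); apply: coord_inj => j.
by rewrite !coord_tup (inj_eq f_inj).
Qed.

Lemma push_dirac0 m n (f : 'I_n -> 'I_m) : push f (dirac0 R M m) = dirac0 R M n.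
Proof.
apply: app_ext => h; rewrite pushE !dirac0E app_lam; congr (h _).
by apply: coord_inj => i; rewrite !coord_tup.
Qed.

Lemma D2_sub_eq (y : D2) :
  (incl (pr2 (incl y)) + lopp 1 * incl (pr1 (incl y))) *
  (incl (pr2 (incl y)) + lopp 1 * incl (pr1 (incl y))) = 0.
Proof.
move: (D_eq (pr1 (incl y))) (D_eq (pr2 (incl y))) (D2_mul y).
move: (incl (pr1 _)) (incl (pr2 _)) => d e Hd He Hde.
ring [Hd He Hde].
Qed.
(** The difference d2 - d1 is again in [D] for a pair in D(2); composing a tangent vector t with it
    exhibits the sum of -t and t as zero. *)
Definition D2_sub (y : D2) : D := elem _ (D2_sub_eq y).

Lemma map_D2_sub : is_map D2_sub.
Proof. by rewrite /D2_sub; map_tac. Qed.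

Lemma D2_sub_l d : D2_sub (D2l d) = Dscale (lopp 1) d.
Proof.
by apply: D_inj; rewrite !(incl_elem, pr1_pair, pr2_pair); ring.
Qed.

Lemma D2_sub_r d : D2_sub (D2r d) = d.
Proof.
by apply: D_inj; rewrite !(incl_elem, pr1_pair, pr2_pair); ring.
Qed.

Lemma D2_sub_diag d : D2_sub (D2diag d) = D0 R.
Proof.
by apply: D_inj; rewrite !(incl_elem, pr1_pair, pr2_pair); ring.
Qed.

Section PushForm.
Variables (m n : nat) (f : 'I_n -> 'I_m) (f_inj : injective f) (w : semiform R M m).

Let push_opp_map : D ~> dist n := mlam (fun d : D => push f (w (Dscale (lopp 1) d))).

Let push_opp_mapE d : push_opp_map d = push f (w (Dscale (lopp 1) d)).
Proof. by rewrite app_lam. Qed.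

Lemma push_opp0 : push_opp_map (D0 R) = dirac0 R M n.
Proof.
rewrite push_opp_mapE; have -> : Dscale (lopp 1) (D0 R) = D0 R.
  by apply: D_inj; rewrite !incl_elem; ring.
by rewrite form_of0 push_dirac0.
Qed.

Lemma push_opp_scale i a d :
  dist_scale i a (push_opp_map d) = push_opp_map (Dscale a d).
Proof.
rewrite !push_opp_mapE dist_scale_push // form_of_scale; congr (push f (w _)).
by apply: D_inj; rewrite !incl_elem; ring.
Qed.

Definition push_opp : semiform R M n := Semiform push_opp0 push_opp_scale.

Lemma push_oppE d : push_opp d = push f (w (Dscale (lopp 1) d)).
Proof. exact: push_opp_mapE. Qed.

End PushForm.

Section Rotations.
Variables p q r : nat.

Definition rot0_fun : 'I_(p + q + r) -> 'I_(p + (q + r)) :=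
  cast_ord (esym (addnA p q r)).
Definition rot1_fun : 'I_(p + q + r) -> 'I_(q + (r + p)) :=
  cast_ord (esym (rot1_eq p q r)) \o (rho1 p q r)^-1%g.
Definition rot2_fun : 'I_(p + q + r) -> 'I_(r + (p + q)) :=
  cast_ord (esym (rot2_eq p q r)) \o (rho2 p q r)^-1%g.

Lemma rot2_inj : injective rot2_fun.
Proof. by move=> i j /cast_ord_inj/perm_inj. Qed.

Ltac coord_nat_tac :=
  repeat (case: ifP => ?); first [by exfalso; lia | by congr (coord_nat _ _); lia].

Lemma rot0_assemble (x : cube p) (y : cube q) (z : cube r) :
  recoord rot0_fun (join_coords x (join_coords y z)) =
  join_coords (join_coords x y) z.
Proof.
apply: eq_coord_nat => i; rewrite coord_nat_recoord !coord_nat_join /=.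
by coord_nat_tac.
Qed.

Lemma rot1_assemble (x : cube p) (y : cube q) (z : cube r) :
  recoord rot1_fun (join_coords y (join_coords z x)) =
  join_coords (join_coords x y) z.
Proof.
apply: eq_coord_nat => i; rewrite coord_nat_recoord /rot1_fun /=.
(* Writing the index as the image under [rho1] of its preimage leaves only values of [rho1], never
   of its inverse, to compute. *)
rewrite -[i in RHS](permKV (rho1 p q r)).
move: ((rho1 p q r)^-1%g i) => {}i; rewrite permE /=.
have lt := ltn_ord i; rewrite !coord_nat_join /rho1_val.
by case: (ltnP i q) => ?; [|case: (ltnP i (q + r)) => ?]; coord_nat_tac.
Qed.

Lemma rot2_assemble (x : cube p) (y : cube q) (z : cube r) :
  recoord rot2_fun (join_coords z (join_coords x y)) =
  join_coords (join_coords x y) z.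
Proof.
apply: eq_coord_nat => i; rewrite coord_nat_recoord /rot2_fun /=.
rewrite -[i in RHS](permKV (rho2 p q r)).
move: ((rho2 p q r)^-1%g i) => {}i; rewrite permE /=.
have lt := ltn_ord i; rewrite !coord_nat_join /rho2_val.
by case: (ltnP i r) => ?; [|case: (ltnP i (p + r)) => ?]; coord_nat_tac.
Qed.

End Rotations.
End Arguments.

Theorem theorem17 (U : cc_universe) (R : line U) (KL : kock_lawvere R)
    (M : space U) (M_microlinear : microlinear R M) (p q r : nat)
    (w1 : semiform R M p) (w2 : semiform R M q) (w3 : semiform R M r) :
  exists (w23 : semiform R M (q + r)) (w31 : semiform R M (r + p))
         (w12 : semiform R M (p + q))
         (j1 : semiform R M (p + (q + r))) (j2 : semiform R M (q + (r + p)))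
         (j3 : semiform R M (r + (p + q))) (s : semiform R M (p + q + r)),
    is_bracket w2 w3 w23 /\ is_bracket w1 w23 j1 /\
    is_bracket w3 w1 w31 /\ is_bracket w2 w31 j2 /\
    is_bracket w1 w2 w12 /\ is_bracket w3 w12 j3 /\
    is_tangent_sum
      (form_cast (addnA p q r) j1)
      (form_permute (rho1 p q r)^-1%g (form_cast (rot1_eq p q r) j2)) s /\
    is_tangent_sum
      s
      (form_permute (rho2 p q r)^-1%g (form_cast (rot2_eq p q r) j3))
      (form_zero R M (p + q + r)).
Proof.
have exB := bracket_exists KL M_microlinear.
have [w23 [k23 [B23 E23]]] := exB _ _ w2 w3.
have [w31 [k31 [B31 E31]]] := exB _ _ w3 w1.
have [w12 [k12 [B12 E12]]] := exB _ _ w1 w2.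
have [j1 [k1 [B1 E1]]] := exB _ _ w1 w23.
have [j2 [k2 [B2 E2]]] := exB _ _ w2 w31.
have [j3 [k3 [B3 E3]]] := exB _ _ w3 w12.
have [l l_run] := run_glue KL M_microlinear w1 w2 w3.
pose c0 : cyclic3 0 1 2 := isT.
pose c1 : cyclic3 1 2 0 := isT.
pose c2 : cyclic3 2 0 1 := isT.
have L1 e : push (rot0_fun (p:=p) (q:=q) (r:=r)) (j1 e) = l (chi c0 (D21_axis e)).
  apply: (push_bracket3 KL M_microlinear l_run c0 E23 E1) => x y z.
  by rewrite rot0_assemble /assemble !app_lam !(pr1_pair, pr2_pair).
have L2 e : push (rot1_fun (p:=p) (q:=q) (r:=r)) (j2 e) = l (chi c1 (D21_axis e)).
  apply: (push_bracket3 KL M_microlinear l_run c1 E31 E2) => x y z.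
  by rewrite rot1_assemble /assemble !app_lam !(pr1_pair, pr2_pair).
have L3 e : push (rot2_fun (p:=p) (q:=q) (r:=r)) (j3 e) = l (chi c2 (D21_axis e)).
  apply: (push_bracket3 KL M_microlinear l_run c2 E12 E3) => x y z.
  by rewrite rot2_assemble /assemble !app_lam !(pr1_pair, pr2_pair).
have J1 d : form_cast (addnA p q r) j1 d = push (rot0_fun (p:=p) (q:=q) (r:=r)) (j1 d).
  exact: form_castE.
have J2 d : form_permute (rho1 p q r)^-1%g (form_cast (rot1_eq p q r) j2) d =
    push (rot1_fun (p:=p) (q:=q) (r:=r)) (j2 d).
  by rewrite form_permuteE form_castE push_push.
have J3 d : form_permute (rho2 p q r)^-1%g (form_cast (rot2_eq p q r) j3) d =
    push (rot2_fun (p:=p) (q:=q) (r:=r)) (j3 d).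
  by rewrite form_permuteE form_castE push_push.
(* The sum of the first two terms is claimed to be the opposite of the third one. *)
exists w23, w31, w12, j1, j2, j3, (push_opp (@rot2_inj p q r) j3).
do 6!split=> //; split.
  pose L : D2 R ~> dist M (power (D R) (p + q + r)) :=
    lam _ (map_app (map_const _ l) (map_phi R)).
  have LE y : L y = l (phi y) by rewrite app_lam.
  apply: (tangent_sum_of KL M_microlinear (l := L)) => d; rewrite LE.
  - by rewrite J1 L1 (phi_l c0).
  - by rewrite J2 L2 (phi_r c1).
  by rewrite push_oppE L3 (phi_diag c2).
(* The third term evaluated at d2 - d1: its opposite on the first axis, itself on the second, and
   the Dirac distribution on the diagonal. *)
pose L : D2 R ~> dist M (power (D R) (p + q + r)) :=
  lam _ (map_app (map_const _ (form_permute (rho2 p q r)^-1%g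
    (form_cast (rot2_eq p q r) j3))) (map_D2_sub R)).
have LE y : L y = push (rot2_fun (p:=p) (q:=q) (r:=r)) (j3 (D2_sub y)).
  by rewrite app_lam J3.
apply: (tangent_sum_of KL M_microlinear (l := L)) => d; rewrite LE.
- by rewrite push_oppE D2_sub_l.
- by rewrite J3 D2_sub_r.
by rewrite D2_sub_diag form_of0 push_dirac0 app_lam.
Qed.
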